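(* Let $n\geqslant 2$ be an integer and $n<p<\infty$. There exists a constant $c_0>0$ depending only on $n$ and $p$ such that the following holds. Let $\mathbb{B}^n=\{x\in\mathbb{R}^n:|x|<1\}$, let $Q:\mathbb{B}^n\to[0,\infty]$ be a function that is locally integrable in $\mathbb{B}^n$ (with respect to Lebesgue measure $m$) and satisfies $$Q_0=\liminf_{\varepsilon\to 0}\frac{1}{\Omega_n\,\varepsilon^n}\int_{B(0,\varepsilon)}Q(x)\,dm(x)>0,$$ where $B(0,\varepsilon)=\{x\in\mathbb{R}^n:|x|<\varepsilon\}$ and $\Omega_n=m(\mathbb{B}^n)$. Let $f:\mathbb{B}^n\to\mathbb{R}^n$ be a continuous, open, discrete mapping with $f(0)=0$ which is a ring $Q$-mapping at the point $x_0=0$ with respect to $p$-modulus. Then $$\limsup_{x\to 0}\frac{|f(x)|}{|x|}\geqslant c_0\,Q_0^{\frac{1}{n-p}}.$$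
   Context: $m$ denotes Lebesgue measure in $\mathbb{R}^n$. A mapping is open if images of open sets are open; it is discrete if the preimage of every point consists of isolated points. Upper limits take values in $[0,\infty]$, and $\infty^{1/(n-p)}=0$ for $p>n$. Modulus. A Borel function $\rho:\mathbb{R}^n\to[0,\infty]$ is admissible for a family $\Gamma$ of curves in $\mathbb{R}^n$, written $\rho\in\mathrm{adm}\,\Gamma$, if $\int_\gamma\rho(x)\,|dx|\geqslant 1$ for all (locally rectifiable) $\gamma\in\Gamma$. For $p\geqslant1$ the $p$-modulus of $\Gamma$ is $M_p(\Gamma)=\inf_{\rho\in\mathrm{adm}\,\Gamma}\int_{\mathbb{R}^n}\rho^p(x)\,dm(x)$. Curve families. For sets $E,F$ and $G$, $\Gamma(E,F,G)$ is the family of all curves $\gamma:[a,b]\to\overline{\mathbb{R}^n}=\mathbb{R}^n\cup\{\infty\}$ with $\gamma(a)\in E$, $\gamma(b)\in F$ and $\gamma(t)\in G$ for $t\in(a,b)$. For a family $\Gamma$ put $f(\Gamma)=\{f\circ\gamma:\gamma\in\Gamma\}$. Ring $Q$-mappings. Let $D\subset\mathbb{R}^n$ be a domain, $x_0\in D$, $Q:D\to[0,\infty]$ Lebesgue measurable, $r_0=\mathrm{dist}(x_0,\partial D)$. A continuous mapping $f$ on $D$ is a ring $Q$-mapping at $x_0$ with respect to $p$-modulus if for all $0<r_1<r_2<r_0$, with $A=\{x\in\mathbb{R}^n:r_1<|x-x_0|<r_2\}$ and $S_i=\{x\in\mathbb{R}^n:|x-x_0|=r_i\}$, $i=1,2$,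 the inequality $$M_p\big(f(\Gamma(S_1,S_2,A))\big)\leqslant\int_A Q(x)\,\eta^p(|x-x_0|)\,dm(x)$$ holds for every Lebesgue measurable $\eta:(r_1,r_2)\to[0,\infty]$ with $\int_{r_1}^{r_2}\eta(r)\,dr\geqslant1$. Here $D=\mathbb{B}^n$, $x_0=0$, $r_0=1$. *)

(* Defs.v *)
From HB Require Import structures.
From mathcomp Require Import all_boot all_order all_algebra.
From mathcomp Require Import all_classical all_reals all_analysis.
From mathcomp Require Import measurable_realfun.

Set Implicit Arguments.
Unset Strict Implicit.
Unset Printing Implicit Defensive.

Import Order.TTheory GRing.Theory Num.Theory.
Import numFieldNormedType.Exports.

Local Open Scope classical_set_scope.
Local Open Scope ring_scope.

Notation borel_rV R n := (g_sigma_algebraType (@open 'rV[R]_n)).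

Section cons_rV.
Context {R : realType} {n : nat}.

Definition cons_rV (xv : measurableTypeR R * borel_rV R n) : borel_rV R n.+1 :=
  (\row_i oapp (xv.2 0) xv.1 (unlift 0 i) : 'rV[R]_n.+1).

Definition uncons_rV (w : borel_rV R n.+1) : measurableTypeR R * borel_rV R n :=
  (w 0 0, \row_i w 0 (lift 0 i)).

Lemma cons_rVK : cancel cons_rV uncons_rV.
Proof.
move=> [x v]; rewrite /uncons_rV /cons_rV /=; congr pair.
  by rewrite mxE unlift_none.
by apply/rowP => i; rewrite !mxE liftK.
Qed.

Lemma measurable_uncons_rV : measurable_fun setT uncons_rV.
Proof.
apply: measurable_fun_pair.
  apply: (measurability _ (RGenOpens.measurableE R)).
  move=> _ [_ [a [b ->] <-]].
  rewrite setTI; apply: sub_sigma_algebra.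
  apply: open_comp; last exact: interval_open.
  by move=> /= w _; exact: coord_continuous.
apply: (@measurability _ _ _ (borel_rV R n) _ _ (@open 'rV[R]_n)) => //.
move=> _ [U oU <-]; rewrite setTI; apply: sub_sigma_algebra => /=.
apply: open_comp => //= w _ A [P nP sPA].
exists (fun i j => if unlift 0 j is Some k then P i k else setT).
  move=> i j; case: unliftP => [k ->|_]; last exact: filterT.
  by have := nP i k; rewrite mxE ord1.
move=> w' Pw'; apply: sPA => i j; have := Pw' i (lift 0 j).
by rewrite liftK mxE ord1.
Qed.

Lemma measurable_cons_rV : measurable_fun setT cons_rV.
Proof.
apply: (@measurability _ _ _ (borel_rV R n.+1) _ _ (@open 'rV[R]_n.+1)) => //.
move=> _ [U oU <-]; rewrite setTI.
pose box (c : rat * 'rV[rat]_n * nat) :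
    set (measurableTypeR R * borel_rV R n) :=
  (ball (ratr c.1.1 : R) c.2.+1%:R^-1) `*`
  (ball (map_mx ratr c.1.2 : 'rV[R]_n) c.2.+1%:R^-1)°.
pose D := [set c | box c `<=` cons_rV @^-1` U].
have -> : cons_rV @^-1` U =
    \bigcup_k \bigcup_(c in [set c | D c /\ pickle c = k]) box c.
  apply/seteqP; split=> [[x v] Uxv|xv [_ _ [c [+ _] cxv]]]; last by apply.
  have /nbhs_ballP[e /= e0 sU] : nbhs (cons_rV (x, v) : 'rV[R]_n.+1) U.
    exact: open_nbhs_nbhs.
  have [k] : exists k, 0 + k.+1%:R^-1 < e / 2.
    by apply: ltr_add_invr; rewrite divr_gt0.
  rewrite add0r => ke.
  have k0 : (0 : R) < k.+1%:R^-1 by rewrite invr_gt0.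
  have dens (y : R) : exists q : rat, `|ratr q - y| < k.+1%:R^-1.
    have [|q] := @rat_in_itvoo _ (y - k.+1%:R^-1) (y + k.+1%:R^-1).
      by rewrite ltrBlDr -addrA ltrDl addr_gt0.
    by rewrite in_itv /= -ltr_distlC distrC; exists q.
  have [q qx] := dens x.
  have /choice[c cv] := fun i => dens (v 0 i).
  have tri (a b z : R) : `|a - z| < k.+1%:R^-1 -> `|a - b| < k.+1%:R^-1 ->
      `|z - b| < e.
    move=> az ab; rewrite (le_lt_trans (ler_distD a _ _))// distrC.
    by rewrite (splitr e) ltrD// (lt_trans _ ke).
  exists (pickle (q, (\row_i c i : 'rV_n), k)) => //.
  exists (q, (\row_i c i : 'rV_n), k).
    split => // -[y u] [/= qy /interior_subset[_ cu]] /=; apply: sU.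
    split => // i j; rewrite !mxE /=; case: unliftP => [l _|_] /=.
      by have := cu 0 l; rewrite !mxE; apply: tri; exact: cv.
    exact: tri qx qy.
  split => //=; exists (fun _ j => ball (v 0 j) (k.+1%:R^-1 - `|ratr (c j) - v 0 j|)).
    move=> i j; rewrite ord1; apply: nbhsx_ballx.
    by rewrite subr_gt0.
  move=> u cu; split => // i j; rewrite !mxE.
  have := cu i j; rewrite ord1 /ball /= ltrBrDl.
  exact/le_lt_trans/ler_distD.
apply: bigcupT_measurable => k.
have [[c [Dc ck]]|nD] := pselect (exists c, D c /\ pickle c = k); last first.
  rewrite (_ : \bigcup_(_ in _) _ = set0)//; apply/seteqP; split => // z [c Dc _].
  by apply: nD; exists c.
rewrite (_ : \bigcup_(_ in _) _ = box c).
  apply: measurableX; first exact: open_measurable (ball_open _ _).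
  by apply: sub_sigma_algebra; exact: open_interior.
apply/seteqP; split => [z [c' [_ +]]|z cz]; last by exists c.
by rewrite -ck => /(pcan_inj pickleK) ->.
Qed.

End cons_rV.

(* Lebesgue measure on the Borel sets of R^n, by recursion on n: R^(n+1) carries
   the image of (lebesgue measure on R) \x (lebesgue measure on R^n) under
   (x, v) |-> (x, v_0, ..., v_(n-1)), and R^0 carries the unit point mass. *)
Section lebesgue_rV.
Context {R : realType}.
Local Open Scope ereal_scope.

Section step.
Context {n : nat} (m : {sigma_finite_measure set (borel_rV R n) -> \bar R}).

Definition lebesgue_rVS : set (borel_rV R n.+1) -> \bar R :=
  pushforward (@lebesgue_measure R \x m) cons_rV.

Let lebesgue_rVS0 : lebesgue_rVS set0 = 0.
Proof. by rewrite /lebesgue_rVS /pushforward preimage_set0 measure0. Qed.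

Let lebesgue_rVS_ge0 A : 0 <= lebesgue_rVS A.
Proof. exact: (measure_ge0 (@lebesgue_measure R \x m)). Qed.

Let lebesgue_rVS_sigma_additive : semi_sigma_additive lebesgue_rVS.
Proof.
move=> F mF tF mUF; rewrite /lebesgue_rVS /pushforward preimage_bigcup.
have mpre A : measurable A -> measurable (cons_rV @^-1` A).
  by move=> mA; rewrite -[X in measurable X]setTI; exact: measurable_cons_rV.
apply: measure_semi_sigma_additive.
- by move=> k; exact: mpre.
- apply/trivIsetP => /= i j _ _ ij; rewrite -preimage_setI.
  by move/trivIsetP : tF => /(_ _ _ _ _ ij) ->//; rewrite preimage_set0.
- by rewrite -preimage_bigcup; exact: mpre.
Qed.

HB.instance Definition _ := isMeasure.Build _ _ _ lebesgue_rVS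
  lebesgue_rVS0 lebesgue_rVS_ge0 lebesgue_rVS_sigma_additive.

Let lebesgue_rVS_sigma_finite : sigma_finite setT lebesgue_rVS.
Proof.
have /sigma_finiteP[F [TF ndF Foo]] := sigma_finiteT (@lebesgue_measure R).
have /sigma_finiteP[G [TG ndG Goo]] := sigma_finiteT m.
exists (fun k => uncons_rV @^-1` (F k `*` G k)).
  rewrite -preimage_bigcup (_ : \bigcup_k _ = setT) ?preimage_setT//.
  rewrite -subTset => -[x y] _.
  have [i _ Fix] : (\bigcup_i F i) x by rewrite -TF.
  have [j _ Gjy] : (\bigcup_j G j) y by rewrite -TG.
  exists (maxn i j) => //; split.
    by move: x Fix; exact/subsetPset/ndF/leq_maxl.
  by move: y Gjy; exact/subsetPset/ndG/leq_maxr.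
move=> k; have [mF Fk] := Foo k; have [mG Gk] := Goo k; split.
  rewrite -[X in measurable X]setTI; apply: measurable_uncons_rV => //.
  exact: measurableX.
rewrite /lebesgue_rVS /pushforward -comp_preimage.
rewrite (_ : uncons_rV \o cons_rV = id).
  by rewrite preimage_id product_measure1E// lte_mul_pinfty// ge0_fin_numE.
by apply/funext => z; exact: cons_rVK.
Qed.

HB.instance Definition _ := Measure_isSigmaFinite.Build _ _ _ lebesgue_rVS
  lebesgue_rVS_sigma_finite.

End step.

Fixpoint lebesgue_rV (n : nat) : {sigma_finite_measure set (borel_rV R n) -> \bar R} :=
  match n with
  | 0 => @dirac _ (borel_rV R 0) (0%R : 'rV[R]_0) R
  | n.+1 => lebesgue_rVS (lebesgue_rV n)
  end.

End lebesgue_rV.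

(* The completion of [lebesgue_rV]: the measurable sets of [lebesgue_type R n]
   are the Lebesgue measurable subsets of R^n.  This is the construction by
   which the library obtains [completed_lebesgue_measure] on R. *)
Notation lebesgue_type R n := (caratheodory_type ((@lebesgue_rV R n)^*)%mu).

Definition leb {R : realType} {n : nat} : set (lebesgue_type R n) -> \bar R :=
  @completed_measure_extension _ _ _ (@lebesgue_rV R n).
HB.instance Definition _ (R : realType) (n : nat) := Measure.on (@leb R n).

(* The domain of [completed_lebesgue_measure]: its measurable sets are the
   Lebesgue measurable subsets of R. *)
Notation lebesgue_typeR R :=
  (caratheodory_type ((wlength (idfun : R -> R))^*)%mu).

Section euclidean.
Context {R : realType} {n : nat}.
Implicit Types (x y c : 'rV[R]_n) (r : R).

(* The norm of the library on 'rV[R]_n is the sup norm; it induces the same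
   topology as the Euclidean norm. *)
Definition enorm x : R := Num.sqrt (\sum_i x 0 i ^+ 2).

Definition eball c r : set 'rV[R]_n := [set x | enorm (x - c) < r].

Definition esphere c r : set 'rV[R]_n := [set x | enorm (x - c) = r].

Definition ering c r1 r2 : set 'rV[R]_n :=
  [set x | r1 < enorm (x - c) < r2].

Definition edist_to c (A : set 'rV[R]_n) : \bar R :=
  ereal_inf [set (enorm (c - y))%:E | y in A].

End euclidean.

Section curves.
Context {R : realType} {n : nat}.

(* Only the values of [curve_fun] on [curve_lo, curve_hi] are relevant. *)
Record curve := Curve {
  curve_lo : R ;
  curve_hi : R ;
  curve_fun :> R -> 'rV[R]_n }.

Implicit Types (g : curve) (Gm : set curve).

Definition arclength (h : R -> 'rV[R]_n) (a b : R) : \bar R :=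
  ereal_sup [set (\sum_(0 <= k < size s)
      enorm (h (nth b (a :: s) k.+1) - h (nth b (a :: s) k)))%:E
    | s in itv_partition a b].

Definition curve_length g : \bar R := arclength g (curve_lo g) (curve_hi g).

(* A curve on a compact interval is locally rectifiable iff it is
   rectifiable. *)
Definition rectifiable g : Prop := (curve_length g < +oo)%E.

(* The arc length parametrization on [0, length]; g has the same value at all
   times t at which the length travelled is u. *)
Definition arc_param g (u : R) : 'rV[R]_n :=
  g (xget (curve_lo g) [set t | curve_lo g <= t <= curve_hi g /\
                                arclength g (curve_lo g) t = u%:E]).

Definition line_integral (rho : 'rV[R]_n -> \bar R) g : \bar R :=
  (\int[lebesgue_measure]_(u in `[0%R, fine (curve_length g)])
     rho (arc_param g u))%E.

(* For E, F, G contained in R^n, curves in the extended space with endpoints in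
   E and F and all other values in G never meet the point at infinity. *)
Definition curve_family (E F G : set 'rV[R]_n) : set curve :=
  [set g | [/\ curve_lo g < curve_hi g,
               {within `[curve_lo g, curve_hi g], continuous g},
               E (g (curve_lo g)),
               F (g (curve_hi g)) &
               forall t, curve_lo g < t < curve_hi g -> G (g t)]].

Definition image_family (f : 'rV[R]_n -> 'rV[R]_n) Gm : set curve :=
  [set Curve (curve_lo g) (curve_hi g) (f \o g) | g in Gm].

Definition admissible Gm : set ('rV[R]_n -> \bar R) :=
  [set rho | [/\ measurable_fun [set: borel_rV R n] rho,
                 (forall x, 0 <= rho x)%E &
                 forall g, Gm g -> rectifiable g ->
                   (1 <= line_integral rho g)%E]].

Definition modulus (p : R) Gm : \bar R :=
  ereal_inf [set (\int[leb]_x (rho x `^ p))%E | rho in admissible Gm].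

End curves.

Section mappings.
Context {R : realType} {n : nat}.
Implicit Types (D : set 'rV[R]_n) (f : 'rV[R]_n -> 'rV[R]_n)
  (Q : 'rV[R]_n -> \bar R).

Definition open_mapping D f : Prop :=
  forall U, open U -> U `<=` D -> open (f @` U).

Definition discrete_mapping D f : Prop :=
  forall y, D `&` f @^-1` [set y] `<=` isolated (D `&` f @^-1` [set y]).

Definition locally_integrable_rV D Q : Prop :=
  measurable_fun (D : set (lebesgue_type R n)) Q /\
  forall K, compact K -> K `<=` D -> (\int[leb]_(x in K) `|Q x| < +oo)%E.

Definition ring_Q_mapping (p : R) D (x0 : 'rV[R]_n) Q f : Prop :=
  {within D, continuous f} /\
  forall r1 r2 : R, 0 < r1 -> r1 < r2 ->
    (r2%:E < edist_to x0 (closure D `\` D°))%E ->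
  forall eta : R -> \bar R,
    measurable_fun (`]r1, r2[%classic : set (lebesgue_typeR R)) eta ->
    (forall r, r1 < r < r2 -> (0 <= eta r)%E) ->
    (1 <= \int[completed_lebesgue_measure]_(r in `]r1, r2[) eta r)%E ->
  (modulus p (image_family f
     (curve_family (esphere x0 r1) (esphere x0 r2) (ering x0 r1 r2)))
   <= \int[leb]_(x in ering x0 r1 r2)
        (Q x * (eta (enorm (x - x0)%R) `^ p)))%E.

Definition lower_density0 Q : \bar R :=
  limf_einf (fun eps : R =>
    (\int[leb]_(x in eball (0 : 'rV[R]_n) eps) Q x) /
    (leb (eball (0 : 'rV[R]_n) 1) * (eps ^+ n)%:E))%E 0^'+.

End mappings.

(* [poweR] sends +oo to +oo for every nonzero exponent; for a negative exponent
   s the convention +oo^s = 0 is needed. *)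
Definition npoweR {R : realType} (x : \bar R) (s : R) : \bar R :=
  if x is +oo%E then 0%E else (x `^ s)%E.

(* Main.v *)
Require Import Defs.
From HB Require Import structures.
From mathcomp Require Import all_boot all_order all_algebra.
From mathcomp Require Import all_classical all_reals all_analysis.
From mathcomp Require Import measurable_realfun.
From mathcomp Require Import zify ring lra.

Set Implicit Arguments.
Unset Strict Implicit.
Unset Printing Implicit Defensive.

Import Order.TTheory GRing.Theory Num.Theory.
Import numFieldNormedType.Exports.

Local Open Scope classical_set_scope.
Local Open Scope ring_scope.

(** Let L bound |f| on the closed ball of radius r2.  A ray {t v} from f(0) = 0
   lifts under f, starting at 0, to a path that leaves this ball, because |t v|
   exceeds L for large t; cutting the lift between its last exit from the
   r1-sphere and its first hit of the r2-sphere gives a curve of the ring whose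
   image is a segment of the ray.  Hence an admissible rho satisfies
   |v| int_0^L rho(t v) dt >= 1 for every v.  As p > n, the rays v = (1, w) with w
   in the unit cube of R^(n-1) already force int rho^p >= c L^(n-p): the map
   (t, w) |-> (t, t w) has Jacobian t^(n-1).  With r1 = e/2, r2 = e, eta = 2/e and
   |f(x)| <= M |x| near 0, the ring inequality becomes
   c (M e)^(n-p) <= (2/e)^p int_(B(0,e)) Q, and e -> 0 bounds M below. *)

(** * Lifting paths through discrete open mappings *)

(** A discrete open map need not have local inverses, so lifts are neither unique nor obtained by
    continuing an inverse branch. The lift is a limit of chains of preimages: openness, uniform on a
    compact set, supplies the next point, and discreteness keeps a chain from drifting while its
    image hardly moves. Chains stop once they leave the compact set, so the limit lies over a
    reparametrized ray [beta \o c], not the ray itself; as [c] is nondecreasing and 1-Lipschitz this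
    is harmless, line integrals being taken in arc length. Nothing bounds from below the parameter
    at which an image segment starts: [f] may be small on the inner sphere, or even vanish there.
    The radial integrals must therefore reach down to 0, and this is where p > n enters. The
    directions (1, w) replace the unit sphere because they avoid polar coordinates and fit a measure
    built as an iterated product; their norms lie between 1 and sqrt n, which fixes [K]. The final
    constant is c0 = (C / (2^p Omega_n))^(1/(p-n)), with C the constant of the modulus bound. *)

Lemma near_right_ex {R : realType} (a : R) (P : R -> Prop) :
  (\forall d \near a^'+, P d) -> exists2 d, a < d & P d.
Proof.
move=> Pa; have : \forall d \near a^'+, a < d /\ P d.
  by apply: filterI => //; exact: nbhs_right_gt.
by move=> /(@filter_ex _ _ _)[d [ad Pd]]; exists d.
Qed.

(** One ultrafilter gives limits at all times [t] of the lift simultaneously, without extracting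
    diagonal subsequences. *)
Lemma ultra_cvg_compact (T : topologicalType) I (F : set_system I) (u : I -> T)
    (K : set T) : UltraFilter F -> compact K -> (forall i, K (u i)) ->
  exists2 p, K p & u @ F --> p.
Proof.
move=> FU cK uK; have [|p [Kp clp]] := cK (u @ F) _.
  by have : F [set i | K (u i)] by apply: filterE => i; exact: uK.
exists p => // V Vp; rewrite nbhs_filterE /fmap /=.
have [//|FC] := in_ultra_setVsetC (u @^-1` V) FU.
by have [y [+ Vy]] := clp (~` V) V FC Vp; move=> /(_ Vy).
Qed.

Lemma leq_minn_addr (i l N : nat) : (minn i N <= minn (i + l) N)%N.
Proof. by rewrite leq_min geq_minr andbT (leq_trans (geq_minl _ _))// leq_addr. Qed.

Lemma minn_addB (i l N : nat) : (minn (i + l) N - minn i N <= l)%N.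
Proof. lia. Qed.

Lemma truncn_diff {R : realType} (s t : R) : s <= t ->
  (Num.truncn t)%:R <= (Num.truncn s)%:R + (t - s) + 1 :> R.
Proof.
move=> st; have [t0|t0] := leP 0 t.
  have := truncnS_gt s; rewrite -natr1.
  have : (Num.truncn t)%:R <= t by rewrite truncn_le.
  lra.
rewrite (_ : Num.truncn t = 0%N); last first.
  by rewrite truncn_floor leNgt t0.
have : 0 <= (Num.truncn s)%:R :> R by [].
by rewrite -subr_ge0 in st; lra.
Qed.

Section path_lifting.
Context {R : realType} {X Y : pseudoMetricType R}.
Implicit Types (D K U : set X) (f : X -> Y).

(* Discreteness at [p] gives [f z != f p] on a compact annulus around [p],
   which a chain with almost constant image near [f p] therefore cannot cross. *)
Lemma chain_small (hY : hausdorff_space Y) D K f (eta : R) :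
  compact K -> K `<=` D -> (forall x, D x -> {for x, continuous f}) ->
  (forall y, D `&` f @^-1` [set y] `<=` isolated (D `&` f @^-1` [set y])) ->
  0 < eta ->
  \forall d \near 0^'+, forall (x : nat -> X) m,
    (forall i, (i <= m)%N -> K (x i)) ->
    (forall i, (i < m)%N -> ball (x i) d (x i.+1)) ->
    (forall i, (i <= m)%N -> ball (f (x 0%N)) d (f (x i))) ->
    ball (x 0%N) eta (x m).
Proof.
move=> cK KD cf df eta0.
(* The starting point becomes a parameter, so that compactness of [K] turns a pointwise choice of
   [d] into a uniform one. *)
pose P (d : R) x0 := forall (x : nat -> X) m, x 0%N = x0 ->
    (forall i, (i <= m)%N -> K (x i)) ->
    (forall i, (i < m)%N -> ball (x i) d (x i.+1)) ->
    (forall i, (i <= m)%N -> ball (f (x 0%N)) d (f (x i))) ->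
    ball (x 0%N) eta (x m).
suff : \forall d \near 0^'+, K `<=` P d.
  apply: filterS => d KP x m Kx xd fxd.
  exact: (KP _ (Kx 0%N (leq0n m)) x m).
move/compact_near_coveringP : (cK); apply => p Kp.
have [_ [V nV VE]] : isolated (D `&` f @^-1` [set (f p)]) p.
  by apply: df; split => //; exact: KD.
have Vp z : K z -> V z -> f z = f p -> z = p.
  by move=> Kz Vz fzp; have : [set p] z by rewrite -VE; split=> //; split=> //; exact: KD.
have /nbhs_ballP[s0 /= s00 s0V] := nV.
pose s := Num.min s0 eta.
have s_gt0 : 0 < s by rewrite lt_min s00.
have sV : ball p s `<=` V.
  by apply: subset_trans s0V; apply: le_ball; rewrite ge_min lexx.
have s4 : 0 < s / 4 by rewrite divr_gt0.
(* Steps of size at most s / 4 cannot jump over this annulus. Balls of a pseudometric need be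
   neither open nor closed, hence the closure and the interior. *)
pose N := K `&` (closure (ball p (s / 2)) `\` (ball p (s / 4))°).
have cN : compact N.
  rewrite /N; apply: compact_closedI => //.
  rewrite setDE; apply: closedI; first exact: closed_closure.
  exact: open_closedC (@open_interior _ _).
have [c c0 Nc] : exists2 c, 0 < c & forall z, N z -> ~ ball (f p) c (f z).
  have : \forall c \near 0^'+, N `<=` (fun z => ~ ball (f p) c (f z)).
    move/compact_near_coveringP : cN; apply => z [Kz [zs zs4]].
    have Vz : V z.
      apply: sV; have [|w [pw zw]] := zs (ball z (s / 2)).
        by apply: nbhsx_ballx; rewrite divr_gt0.
      by rewrite (splitr s); apply: ball_triangle pw (ball_sym zw).
    have fzp : f p != f z.
      apply/eqP => fpz; apply: zs4; rewrite (Vp z)//.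
      exact: nbhsx_ballx.
    move: hY; rewrite ball_hausdorff => /(_ _ _ fzp)[[r1 r2] /= /eqP r12].
    near=> z' c => /= pz'.
    suff : set0 (f z') by [].
    rewrite -r12; split.
      by apply: le_ball pz'; near: c; exact: nbhs_right_le.
    by near: z'; apply: (cf _ (KD _ Kz)); exact: nbhsx_ballx.
  by move=> /near_right_ex[c c0 Hc]; exists c.
near=> p' d => /= x m xp' Kx xd fxd.
have pp' : ball p (s / 4) (x 0%N) by rewrite xp'; near: p'; exact: nbhsx_ballx.
have fpp' : ball (f p) (c / 2) (f (x 0%N)).
  rewrite xp'; near: p'; apply: (cf _ (KD _ Kp)); apply: nbhsx_ballx.
  by rewrite divr_gt0.
have chain i : (i <= m)%N -> ball p (s / 4) (x i).
  elim: i => // i IH im; apply: interior_subset; apply: contrapT => ni.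
  apply: (Nc (x i.+1)).
    split; first exact: Kx.
    split => //; apply: subset_closure.
    rewrite (_ : s / 2 = s / 4 + s / 4); last by field.
    apply: ball_triangle (IH (ltnW im)) _.
    by apply: le_ball (xd _ im); near: d; exact: nbhs_right_le.
  rewrite (splitr c); apply: ball_triangle fpp' _.
  apply: le_ball (fxd _ im).
  by near: d; apply: nbhs_right_le; rewrite divr_gt0.
apply: (@le_ball _ _ _ (s / 4 + s / 4)).
  have : s <= eta by rewrite ge_min lexx orbT.
  by rewrite -mulrDl => ?; lra.
exact: ball_triangle (ball_sym pp') (chain m (leqnn m)).
Unshelve. all: by end_near. Qed.

(** The image of a small ball around [x] contains some e-ball around [f x]. Points close to [x]
    inherit a ball of radius e / 2, and compactness of [K] makes the radius uniform. *)
Lemma open_uniform K U f (s : R) :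
  compact K -> open U -> K `<=` U -> (forall x, U x -> {for x, continuous f}) ->
  (forall V, open V -> V `<=` U -> open (f @` V)) -> 0 < s ->
  \forall t \near 0^'+, forall x, K x -> forall y, ball (f x) t y ->
    exists x', [/\ U x', ball x s x' & f x' = y].
Proof.
move=> cK oU KU cf of_ s0.
move/compact_near_coveringP : (cK); apply => x Kx.
have s20 : 0 < s / 2 by rewrite divr_gt0.
pose V := (ball x (s / 2))° `&` U.
have Vx : V x.
  split; last exact: KU.
  by apply: nbhs_singleton; apply: nbhs_interior; exact: nbhsx_ballx.
have : open (f @` V).
  apply: of_; first by apply: openI => //; exact: open_interior.
  exact: subIsetr.
rewrite openE => /(_ (f x)) -/(_ (ex_intro2 _ _ x Vx erefl)).
move=> /nbhs_ballP[e /= e0 eV].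
have e20 : 0 < e / 2 by rewrite divr_gt0.
near=> x' t => /= y x'y.
have [x'' [/interior_subset xx'' Ux''] <-] : (f @` V) y.
  apply: eV; rewrite (splitr e); apply: (@ball_triangle _ _ (f x')).
    near: x'; apply: (cf _ (KU _ Kx)); exact: nbhsx_ballx.
  by apply: le_ball x'y; near: t; exact: nbhs_right_le.
exists x''; split => //; rewrite (splitr s); apply: ball_triangle xx''.
by apply: ball_sym; near: x'; exact: nbhsx_ballx.
Unshelve. all: by end_near. Qed.

Section lifting.
(** A chain is continued only while it is in [K0]; [U] leaves room for the one step that leaves
    [K0], and [K1] is the compact set in which limits are taken. The hypothesis [exit] forces every
    chain to leave [K0]. *)
Variables (K0 K1 U D : set X) (f : X -> Y) (beta : R -> Y) (x0 : X) (T : R).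
Hypotheses (hX : hausdorff_space X) (hY : hausdorff_space Y).
Hypotheses (cK0 : compact K0) (cK1 : compact K1) (oU : open U).
Hypotheses (K0U : K0 `<=` U) (UK1 : U `<=` K1) (K1D : K1 `<=` D).
Hypothesis cf : forall x, D x -> {for x, continuous f}.
Hypothesis of_ : forall V, open V -> V `<=` D -> open (f @` V).
Hypothesis df :
  forall y, D `&` f @^-1` [set y] `<=` isolated (D `&` f @^-1` [set y]).
Hypothesis beta_unif : forall e : R, 0 < e ->
  exists2 d : R, 0 < d & forall s t : R, `|s - t| < d -> ball (beta s) e (beta t).
Hypotheses (K0x0 : K0 x0) (fx0 : f x0 = beta 0).
Hypothesis exit : forall t, T <= t -> forall x, K0 x -> f x <> beta t.

(* [N] is the first index with [x N] outside [K0]; from there on the sequence is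
   constant. *)
Lemma discrete_lift (s : R) : 0 < s ->
  \forall t \near 0^'+, exists (x : nat -> X) N,
    [/\ x 0%N = x0, (forall i, K1 (x i)), (forall i, ball (x i) s (x i.+1)),
        (forall i, f (x i) = beta ((minn i N)%:R * t)) &
        forall i, T <= i%:R * t -> ~ K0 (x i)].
Proof.
move=> s0.
have [e e0 eK] : exists2 e, 0 < e & forall x, K0 x -> forall y, ball (f x) e y ->
    exists x', [/\ U x', ball x s x' & f x' = y].
  have H := @open_uniform K0 U f s cK0 oU K0U (fun x Ux => cf (K1D (UK1 Ux)))
    (fun V oV VU => of_ oV (subset_trans VU (subset_trans UK1 K1D))) s0.
  by have [e e0 eK] := near_right_ex H; exists e.
have [d d0 dbeta] := beta_unif e0.
near=> t.
have t0 : 0 < t by near: t; exact: nbhs_right_gt.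
have bt i : ball (beta (i%:R * t)) e (beta (i.+1%:R * t)).
  apply: dbeta; rewrite -mulrBl -natr1 opprD addNKr normrM normrN1 mul1r gtr0_norm//.
pose next i x := xget x [set x' | [/\ U x', ball x s x' & f x' = beta (i.+1%:R * t)]].
pose x_ := fix x_ i := if i is i.+1 then
  if `[< K0 (x_ i) >] then next i (x_ i) else x_ i else x0.
have xS i : x_ i.+1 = if `[< K0 (x_ i) >] then next i (x_ i) else x_ i by [].
have nextP i : K0 (x_ i) -> f (x_ i) = beta (i%:R * t) ->
    [/\ U (x_ i.+1), ball (x_ i) s (x_ i.+1) & f (x_ i.+1) = beta (i.+1%:R * t)].
  move=> Kx fx; rewrite xS asboolT//.
  suff : exists x, [/\ U x, ball (x_ i) s x & f x = beta (i.+1%:R * t)].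
    by move=> /(@xgetPex _ (x_ i) [set x | _]).
  apply: eK => //; rewrite fx.
  exact: bt.
have xlift i : (forall j, (j < i)%N -> K0 (x_ j)) -> f (x_ i) = beta (i%:R * t).
  elim: i => [|i IH] Kx; first by rewrite mul0r.
  have [] // := nextP i (Kx _ (ltnSn i)).
  by apply: IH => j ji; apply: Kx; exact: ltnW.
(* A chain that never left [K0] would lie over beta (i t) for every i, against [exit] as soon as i t
   >= T. *)
have [N [nKN KN]] : exists N, ~ K0 (x_ N) /\ forall j, (j < N)%N -> K0 (x_ j).
  have exK : exists n, `[< ~ K0 (x_ n) >].
    apply: contrapT => /forallNP allK.
    have KA j : K0 (x_ j) by apply: contrapT => nK; apply: (allK j); exact/asboolP.
    have := @exit _ _ _ (KA (Num.truncn (T / t)).+1) (xlift _ (fun j _ => KA j)); apply.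
    by rewrite -ler_pdivrMr// ltW// truncnS_gt.
  have [N /asboolP NP Nmin] := ex_minnP exK.
  exists N; split => // j; apply: contraPP => nKj; apply/negP; rewrite -leqNgt.
  by apply: Nmin; exact/asboolP.
have frozen i : (N <= i)%N -> x_ i = x_ N.
  elim: i => [|i IH]; first by rewrite leqn0 => /eqP ->.
  rewrite leq_eqVlt => /predU1P[->//|]; rewrite ltnS => /IH xN.
  by rewrite xS xN asboolF.
have lt_step i : (i < N)%N -> [/\ U (x_ i.+1), ball (x_ i) s (x_ i.+1) &
    f (x_ i.+1) = beta (i.+1%:R * t)].
  move=> iN; apply: nextP; first exact: KN.
  by apply: xlift => j ji; apply: KN; exact: ltn_trans iN.
exists x_, N; split => //.
- elim=> [|i IH]; first by apply: UK1; exact: K0U.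
  have [Ni|/lt_step[/UK1]//] := leqP N i.
  by rewrite frozen ?(leq_trans Ni)// -(frozen _ Ni).
- move=> i; have [Ni|/lt_step[]//] := leqP N i.
  rewrite (frozen i) ?(frozen i.+1)//; first exact: ballxx.
  exact: leq_trans (leqnSn i).
- move=> i; rewrite /minn; case: ltnP => [iN|Ni].
    by apply: xlift => j ji; apply: KN; exact: ltn_trans iN.
  by rewrite frozen//; apply: xlift.
- move=> i Ti; have [Ni|iN] := leqP N i; first by rewrite frozen.
  move=> Kx; apply: (exit Ti Kx); apply: xlift => j ji.
  by apply: KN; exact: ltn_trans iN.
Unshelve. all: by end_near. Qed.

(* Discrete lifts of mesh 1/k converge pointwise along an ultrafilter;
   [chain_small] makes them asymptotically equicontinuous, so that the limit is
   continuous. *)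
Theorem path_lift : exists (alpha : R -> X) (c : R -> R),
  [/\ continuous alpha, alpha 0 = x0, (forall t, K1 (alpha t)),
      (forall t, f (alpha t) = beta (c t)) &
      [/\ c 0 = 0, (forall s t, s <= t -> c s <= c t <= c s + (t - s)) &
          exists2 t, 0 < t & ~ (K0° (alpha t))]].
Proof.
have T0 : 0 < T.
  by rewrite ltNge; apply/negP => /exit/(_ _ K0x0).
have step k : exists g : R * (nat -> X) * nat, [/\ 0 < g.1.1 < k.+1%:R^-1,
      g.1.2 0%N = x0, (forall i, K1 (g.1.2 i)) &
      [/\ (forall i, ball (g.1.2 i) k.+1%:R^-1 (g.1.2 i.+1)),
        (forall i, f (g.1.2 i) = beta ((minn i g.2)%:R * g.1.1)) &
        forall i, T <= i%:R * g.1.1 -> ~ K0 (g.1.2 i)]].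
  have k0 : (0 : R) < k.+1%:R^-1 by rewrite invr_gt0.
  have : \forall t \near (0 : R)^'+, t < k.+1%:R^-1 /\ exists (x : nat -> X) N,
    [/\ x 0%N = x0, (forall i, K1 (x i)), (forall i, ball (x i) k.+1%:R^-1 (x i.+1)),
        (forall i, f (x i) = beta ((minn i N)%:R * t)) &
        forall i, T <= i%:R * t -> ~ K0 (x i)].
    by apply: filterI; [exact: nbhs_right_lt|exact: discrete_lift].
  move=> /near_right_ex[t t0 [tk [x [N [? ? ? ? ?]]]]].
  by exists (t, x, N); split => //=; rewrite t0.
have [g gP] := choice step => {step}.
pose tau k := (g k).1.1; pose xs k := (g k).1.2.
have tau0 k : 0 < tau k by have [/andP[]] := gP k.
have tauk k : tau k < k.+1%:R^-1 by have [/andP[]] := gP k.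
pose a k t := xs k (Num.truncn (t / tau k)).
(* The parameter of [beta] actually reached: it stops growing at the index where the chain freezes.
   Up to an error [tau k] it is 1-Lipschitz, and its limit is [c]. *)
pose ck k t : R := (minn (Num.truncn (t / tau k)) (g k).2)%:R * tau k.
have aK k t : K1 (a k t) by have [_ _ + _] := gP k; exact.
have fa k t : f (a k t) = beta (ck k t) by have [_ _ _ [_ + _]] := gP k; exact.
have ck_homo k s t : s <= t -> ck k s <= ck k t.
  move=> st; rewrite ler_pM2r// ler_nat leq_min geq_minr andbT geq_min.
  by rewrite le_truncn// ler_pM2r ?invr_gt0.
have trunc_step k s t : s <= t ->
    ((Num.truncn (t / tau k) - Num.truncn (s / tau k))%N)%:R * tau k <=
      (t - s) + tau k.
  move=> st; have st' : s / tau k <= t / tau k by rewrite ler_pM2r ?invr_gt0.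
  rewrite natrB ?le_truncn// -ler_pdivlMr// mulrDl divff ?gt_eqF// mulrBl.
  by have := truncn_diff st'; lra.
have ck_lip k s t : s <= t -> ck k t <= ck k s + (t - s) + tau k.
  move=> st; have := trunc_step k s t st; rewrite /ck.
  set i := Num.truncn (t / _); set j := Num.truncn (s / _) => ij.
  have ji : (j <= i)%N by rewrite le_truncn// ler_pM2r ?invr_gt0.
  rewrite -addrA -lerBlDl; apply: le_trans ij.
  rewrite -mulrBl ler_pM2r// -natrB ?ler_nat; last first.
    by rewrite -(subnKC ji) leq_minn_addr.
  by rewrite -{1}(subnKC ji) minn_addB.
have [F [FU oF]] := ultraFilterLemma (eventually_filter).
have inv_near (e : R) : 0 < e -> \forall k \near F, k.+1%:R^-1 < e.
  by move=> e0; apply: oF; exact: near_infty_natSinv_lt (PosNum e0).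
have ex_alpha t : exists p : X, K1 p /\ a ^~ t @ F --> p.
  by have [p] := ultra_cvg_compact (u := a ^~ t) FU cK1 (fun k => aK k t); exists p.
have [alpha alphaP] := choice ex_alpha.
have ex_c t : exists p : R, ck ^~ t @ F --> p.
    have [|p _ ckp] := ultra_cvg_compact (u := ck ^~ t) FU (@segment_compact _ 0 `|t|).
    move=> k; rewrite /ck /= in_itv /= mulr_ge0 /= ?(ltW (tau0 k))//.
    have [t0|t0] := leP 0 t.
      rewrite ger0_norm// -ler_pdivlMr//.
      apply: (@le_trans _ _ (Num.truncn (t / tau k))%:R).
        by rewrite ler_nat geq_minl.
      by rewrite truncn_le divr_ge0// ltW.
    rewrite (_ : Num.truncn _ = 0%N) ?min0n ?mul0r ?normr_ge0//.
    by rewrite truncn_floor lt_geF// pmulr_llt0 ?invr_gt0.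
  by exists p.
have [c cP] := choice ex_c.
exists alpha, c; split.
- move=> t; apply/cvg_ballP => e e0.
  have e3 : 0 < e / 3 by rewrite divr_gt0.
  have [d d0 chain] := near_right_ex (chain_small hY cK1 K1D cf df e3).
  have [b b0 bd] := beta_unif d0.
  have ball_lt s u : s <= u -> u - s < b / 2 ->
      \forall k \near F, ball (a k s) (e / 3) (a k u).
    move=> su sub; near=> k.
    have kd : k.+1%:R^-1 < d by near: k; exact: inv_near.
    have kb : k.+1%:R^-1 < b / 2 by near: k; apply: inv_near; rewrite divr_gt0.
    rewrite /a; set i := Num.truncn (s / _); set j := Num.truncn (u / _).
    have ij : (i <= j)%N by rewrite le_truncn// ler_pM2r ?invr_gt0.
    have := chain (fun l => xs k (i + l)%N) (j - i)%N.
    rewrite addn0 subnKC//; apply => l lij.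
    - by have [_ _ + _] := gP k; exact.
    - rewrite addnS; apply: le_ball (ltW kd) _ _.
      by have [_ _ _ [+ _ _]] := gP k; exact.
    - have [_ _ _ [_ fx _]] := gP k.
      rewrite /xs !fx; apply: bd; rewrite -mulrBl normrM (gtr0_norm (tau0 k)).
      apply: (@le_lt_trans _ _ ((j - i)%N%:R * tau k)).
        rewrite ler_pM2r// distrC -natrB ?leq_minn_addr// ger0_norm// ler_nat.
        exact: leq_trans (minn_addB _ _ _) lij.
      apply: le_lt_trans (trunc_step k _ _ su) _.
      by rewrite (splitr b) ltrD// (lt_trans (tauk k)).
  have ball_near s : `|t - s| < b / 2 ->
      \forall k \near F, ball (a k t) (e / 3) (a k s).
    have [ts|/ltW st] := leP t s.
      by rewrite distrC ger0_norm ?subr_ge0//; exact: ball_lt.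
    rewrite ger0_norm ?subr_ge0// => /(ball_lt _ _ st).
    by apply: filterS => k; exact: ball_sym.
  have b20 : 0 < b / 2 by rewrite divr_gt0.
  near=> s.
  have /ball_near ts : `|t - s| < b / 2 by near: s; exact: cvgr_dist_lt.
  have [k [ats [tk sk]]] : exists k, ball (a k t) (e / 3) (a k s) /\
      ball (alpha t) (e / 3) (a k t) /\ ball (alpha s) (e / 3) (a k s).
    apply: (@filter_ex _ F); apply: filterI => //; apply: filterI.
      by apply: (alphaP t).2; exact: nbhsx_ballx.
    by apply: (alphaP s).2; exact: nbhsx_ballx.
  rewrite (_ : e = e / 3 + e / 3 + e / 3); last by field.
  exact: ball_triangle (ball_triangle tk ats) (ball_sym sk).
- apply: (@cvg_unique _ hX (a ^~ 0 @ F) _ _ _ (alphaP 0).2).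
  rewrite (_ : a ^~ 0 = cst x0); first exact: cvg_cst.
  apply/funext => k; rewrite /a mul0r truncn0.
  by have [] := gP k.
- by move=> t; have [] := alphaP t.
- move=> t; have [Kt at_] := alphaP t.
  have : f \o a ^~ t @ F --> f (alpha t).
    by apply: cvg_comp at_ _; exact: cf (K1D Kt).
  move=> fat; apply: (@cvg_unique _ hY _ _ _ _ fat).
  rewrite (_ : f \o _ = beta \o ck ^~ t); last by apply/funext => k; exact: fa.
  apply: cvg_comp (cP t) _; apply/cvg_ballP => e e0.
  have [b b0 be] := beta_unif e0.
  near=> s; apply: be; near: s; exact: cvgr_dist_lt.
split.
- apply: (@cvg_unique _ (@Rhausdorff R) _ _ _ _ (cP 0)).
  rewrite (_ : ck ^~ 0 = cst 0); first exact: cvg_cst.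
  by apply/funext => k; rewrite /ck mul0r truncn0 min0n mul0r.
- move=> s t st; apply/andP; split.
    by apply: ler_cvg_to (cP s) (cP t) _; apply: nearW => k; exact: ck_homo.
  apply/ler_addgt0Pr => e e0.
  have h : (fun k => ck k s + (t - s) + e) @ F --> c s + (t - s) + e.
    by do 2 apply: cvgD (cvg_cst _); exact: cP.
  apply: ler_cvg_to (cP t) h _; near=> k.
  apply: le_trans (ck_lip k _ _ st) _; rewrite lerD2l.
  apply: le_trans (ltW (tauk k)) _; apply: ltW; near: k; exact: inv_near.
(* The extra 1 absorbs the time lost by rounding down to a multiple of [tau k] < 1. A limit of
   points outside [K0] can lie on the boundary, so only the interior is avoided. *)
exists (T + 1); first by rewrite addr_gt0.
have [Kt at_] := alphaP (T + 1) => /at_ K0F.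
have {}K0F : F [set k | K0 (a k (T + 1))] by [].

have : F set0; last exact: filter_not_empty.
have TF : \forall k \near F, T <= (Num.truncn ((T + 1) / tau k))%:R * tau k.
  near=> k; have k1 : tau k < 1.
    by apply: lt_le_trans (tauk k) _; rewrite invf_le1// ler1n.
  have := truncnS_gt ((T + 1) / tau k); rewrite ltr_pdivrMr// -natr1 mulrDl mul1r.
  by lra.
apply: filterS2 K0F TF => k /= + Tk.
by have [_ _ _ [_ _ /(_ _ Tk)]] := gP k.
Unshelve. all: by end_near. Qed.

End lifting.
End path_lifting.

(** * Lebesgue measure on R^n *)

Section lebesgue_affine.
Context {R : realType}.
Local Open Scope ereal_scope.
Notation mu := (@lebesgue_measure R).
Variables (a b : R).
Hypothesis a0 : (0 < a)%R.

Let phi (x : measurableTypeR R) : measurableTypeR R := (a * x + b)%R.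

Let mphi : measurable_fun setT phi.
Proof. by apply: measurable_funD => //; exact: measurable_funM. Qed.

(** Both measures agree on half-open intervals, and these determine Lebesgue measure. *)
Let lebesgue_measure_affine (A : set (measurableTypeR R)) : measurable A ->
  mu A = pushforward (mscale (NngNum (ltW a0)) mu) phi A.
Proof.
move=> mA; apply: lebesgue_measure_unique mA => //= _ [[x y]] _ <-.
rewrite /pushforward /mscale /=.
rewrite (_ : phi @^-1` _ = [set` `](x - b) / a, (y - b) / a]%R]); last first.
  apply/seteqP; split => z; rewrite /= !in_itv /= /phi ltr_pdivrMr// ler_pdivlMr//;
  by rewrite ltrBlDr lerBrDr mulrC.
rewrite !lebesgue_measure_itv /= !lte_fin ltr_pM2r ?invr_gt0// ltrD2r.
case: ifPn => [xy|_]; last by rewrite mule0.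
by rewrite -!EFinB -EFinM; congr EFin; field; exact: lt0r_neq0.
Qed.

Lemma ge0_integral_affine (h : R -> \bar R) : measurable_fun setT h ->
  (forall x, 0 <= h x) ->
  \int[mu]_x h x = a%:E * \int[mu]_x h (a * x + b)%R.
Proof.
move=> mh h0.
rewrite (eq_measure_integral (pushforward (mscale (NngNum (ltW a0)) mu) phi)); last first.
  by move=> A mA _; exact: lebesgue_measure_affine.
rewrite ge0_integral_pushforward// preimage_setT ge0_integral_mscale//=.
exact: measurableT_comp mh mphi.
Qed.

End lebesgue_affine.

Lemma measurable_fun_rV {R : realType} d (T : measurableType d) n
    (g : T -> borel_rV R n) :
  (forall i, measurable_fun setT (fun t => (g t : 'rV[R]_n) 0 i : measurableTypeR R)) ->
  measurable_fun setT g.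
Proof.
elim: n g => [g _|n IH g mg].
  rewrite (_ : g = cst (0 : 'rV_0)); first exact: measurable_cst.
  by apply/funext => t; apply/rowP => -[].
pose h t : measurableTypeR R * borel_rV R n :=
  ((g t : 'rV[R]_n.+1) 0 0, \row_i (g t : 'rV[R]_n.+1) 0 (lift 0 i)).
rewrite (_ : g = cons_rV \o h).
  apply: measurableT_comp; first exact: measurable_cons_rV.
  apply: measurable_fun_pair; first exact: mg.
  by apply: IH => i; under eq_fun do rewrite mxE; exact: mg.
apply/funext => t; apply/rowP => i; rewrite /h /cons_rV /= !mxE /=.
by case: unliftP => [j ->|->] /=; rewrite ?mxE.
Qed.

Lemma measurable_coord {R : realType} n (i : 'I_n) :
  measurable_fun setT (fun w : borel_rV R n => (w : 'rV[R]_n) 0 i : measurableTypeR R).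
Proof.
apply: (measurability _ (RGenOpens.measurableE R)).
move=> _ [_ [a [b ->] <-]]; rewrite setTI; apply: sub_sigma_algebra.
apply: open_comp; last exact: interval_open.
by move=> /= w _; exact: coord_continuous.
Qed.

Lemma measurable_scale_rV {R : realType} n :
  measurable_fun setT (fun z : measurableTypeR R * borel_rV R n =>
    (z.1 *: (z.2 : 'rV[R]_n)) : borel_rV R n).
Proof.
apply: measurable_fun_rV => i; under eq_fun do rewrite mxE.
apply: measurable_funM; first exact: measurable_fst.
by apply: measurableT_comp (measurable_coord i) _; exact: measurable_snd.
Qed.

Section lebesgue_rV_integral.
Context {R : realType}.
Local Open Scope ereal_scope.
Notation mu := (@lebesgue_measure R).

Lemma ge0_integral_lebesgue_rVS n (h : borel_rV R n.+1 -> \bar R) :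
  measurable_fun setT h -> (forall x, 0 <= h x) ->
  \int[lebesgue_rV n.+1]_w h w =
  \int[mu]_x \int[lebesgue_rV n]_v h (cons_rV (x, v)).
Proof.
move=> mh h0.
rewrite [LHS](_ : _ =
    \int[pushforward (mu \x lebesgue_rV n) (@cons_rV R n)]_w h w)//.
rewrite ge0_integral_pushforward//=; last exact: measurable_cons_rV.
rewrite preimage_setT fubini_tonelli1//.
by apply: measurableT_comp => //; exact: measurable_cons_rV.
Qed.

(** Induction on the dimension: the affine substitution in the leading coordinate contributes one
    factor t, the induction hypothesis the others. *)
Lemma ge0_integral_scale_rV n (t : R) (h : borel_rV R n -> \bar R) :
  (0 < t)%R -> measurable_fun setT h -> (forall x, 0 <= h x) ->
  \int[lebesgue_rV n]_w h w =
  (t ^+ n)%:E * \int[lebesgue_rV n]_w h (t *: (w : 'rV[R]_n))%R.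
Proof.
move=> t0; elim: n h => [|n IH] h mh h0.
  rewrite expr0 mul1e; apply: eq_integral => w _; congr h.
  by apply/rowP => -[].
have mht : measurable_fun setT (fun w : borel_rV R n.+1 => h (t *: (w : 'rV[R]_n.+1))%R).
  apply: measurableT_comp mh _; apply: measurable_fun_rV => i.
  under eq_fun do rewrite mxE.
  by apply: measurable_funM => //; exact: measurable_coord.
rewrite !ge0_integral_lebesgue_rVS//.
have mhc : measurable_fun setT (h \o @cons_rV R n).
  by apply: measurableT_comp => //; exact: measurable_cons_rV.
have mhx x : measurable_fun setT (fun v => h (cons_rV (x, v))).
  exact: measurableT_comp mhc (pair1_measurable x).
have mF : measurable_fun setT (fun x => \int[lebesgue_rV n]_v h (cons_rV (x, v))).
  exact: (@measurable_fun_fubini_tonelli_F _ _ _ _ _ (lebesgue_rV n)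
    (h \o @cons_rV R n) mhc (fun z => h0 _)).
rewrite (ge0_integral_affine 0 t0)//; last by move=> x; exact: integral_ge0.
rewrite exprS EFinM -muleA; congr *%E.
rewrite -ge0_integralZl_EFin ?exprn_ge0 ?ltW//.
- apply: eq_integral => x _; rewrite addr0 IH//; congr *%E.
  apply: eq_integral => v _; congr h; apply/rowP => i; rewrite !mxE /=.
  by case: unliftP => [j _|_] /=; rewrite ?mxE.
- by move=> x _; exact: integral_ge0.
- exact: (@measurable_fun_fubini_tonelli_F _ _ _ _ _ (lebesgue_rV n)
    ((fun w : borel_rV R n.+1 => h (t *: (w : 'rV[R]_n.+1))%R) \o @cons_rV R n)
    (measurableT_comp mht measurable_cons_rV) (fun z => h0 _)).
Qed.

Lemma measurable_box n (a b : R) :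
  measurable ([set w | forall i, (a <= (w : 'rV[R]_n) 0 i <= b)%R] : set (borel_rV R n)).
Proof.
rewrite (_ : [set w | _] =
    \bigcap_(i in [set: 'I_n]) [set w : 'rV[R]_n | (a <= w 0 i <= b)%R]).
  apply: fin_bigcap_measurable => // i _.
  rewrite -[X in measurable X]setTI.
  have := @measurable_coord R n i measurableT `[a, b]%classic.
  rewrite (_ : _ @^-1` _ = [set w : 'rV[R]_n | (a <= w 0 i <= b)%R]); first exact.
  by apply/seteqP; split => w /=; rewrite in_itv.
by apply/seteqP; split => [w wab i _|w wab i]; [exact: wab|exact: (wab i)].
Qed.

Lemma lebesgue_rV_box n (a b : R) : (a <= b)%R ->
  lebesgue_rV n [set w : 'rV[R]_n | forall i, (a <= w 0 i <= b)%R] = ((b - a) ^+ n)%:E.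
Proof.
move=> ab; elim: n => [|n IH].
  by rewrite /= diracE mem_set ?expr0// => -[].
rewrite exprS EFinM -IH.
rewrite [LHS](_ : _ = (mu \x lebesgue_rV n) (`[a, b]%classic `*`
   [set w : 'rV[R]_n | forall i, (a <= w 0 i <= b)%R])).
  rewrite product_measure1E//; last exact: measurable_box.
  congr *%E; rewrite /= lebesgue_measure_itv /= lte_fin.
  by case: ltgtP ab => // -> _; rewrite subrr.
rewrite /= /lebesgue_rVS /pushforward; congr (_ _).
apply/seteqP; split => [[x v] /= xv|[x v] /= [xab vab] i].
  split; first by have := xv ord0; rewrite mxE unlift_none in_itv.
  by move=> i; have := xv (lift ord0 i); rewrite mxE liftK.
rewrite mxE; case: unliftP => [j _|_] /=; first exact: vab.
by move: xab; rewrite in_itv.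
Qed.

End lebesgue_rV_integral.

Section completed_lebesgue.
Context {R : realType} {n : nat}.
Local Open Scope ereal_scope.

Lemma measurable_lebesgue_type (A : set (borel_rV R n)) :
  measurable A -> measurable (A : set (lebesgue_type R n)).
Proof. exact: caratheodory_measurable_mu_ext. Qed.

Lemma lebE (A : set (borel_rV R n)) : measurable A -> leb A = lebesgue_rV n A.
Proof. by move=> mA; rewrite /leb /completed_measure_extension measurable_mu_extE. Qed.

(** Admissible densities are Borel, so their modulus integral can be moved from the completion to
    the product measure, where Tonelli applies. *)
Lemma ge0_integral_leb (h : borel_rV R n -> \bar R) :
  measurable_fun setT h -> (forall x, 0 <= h x) ->
  \int[leb]_x h x = \int[lebesgue_rV n]_x h x.
Proof.
move=> mh h0.
pose phi (x : lebesgue_type R n) : borel_rV R n := x.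
have mphi : measurable_fun setT phi.
  by move=> _ A mA; rewrite setTI; exact: measurable_lebesgue_type.
transitivity (\int[pushforward leb phi]_x h x).
  by rewrite ge0_integral_pushforward.
apply: eq_measure_integral => A mA _; rewrite /pushforward; exact: lebE.
Qed.

End completed_lebesgue.

(** * A weighted one-dimensional estimate along a ray *)

Section radial.
Context {R : realType}.
Notation mu := (@lebesgue_measure R).

Lemma continuous_powR (b x : R) : 0 < x -> {for x, continuous (fun t : R => t `^ b)}.
Proof.
move=> x0; apply/differentiable_continuous/derivable1_diffP/derivable_powR.
by rewrite in_itv/= x0.
Qed.

(** The integrand may blow up at 0, so ]0, L] is exhausted by the intervals [1/(k+1), L]; on each
    the fundamental theorem of calculus applies, and the antiderivative at the lower end is
    nonnegative. *)
Lemma le_integral_powR (b L : R) : 0 <= b < 1 -> 0 < L ->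
  (\int[mu]_(t in `]0%R, L]) (t `^ (- b))%:E <= (L `^ (1 - b) / (1 - b))%:E)%E.
Proof.
move=> /andP[b0 b1] L0.
have b1' : 0 < 1 - b by rewrite subr_gt0.
pose A k : set R := `[k.+1%:R^-1, L]%classic.
have -> : [set` `]0%R, L]] = \bigcup_k A k.
  apply/seteqP; split => [t|t [k _]]; rewrite /A /= !in_itv /= => /andP[t0 tL]; last first.
    by rewrite tL andbT (lt_le_trans _ t0)// invr_gt0.
  have [k kt] : exists k, 0 + k.+1%:R^-1 < t by exact: ltr_add_invr.
  by exists k => //; rewrite /A /= in_itv/= tL andbT ltW// -[X in X < _]add0r.
have mpow : measurable_fun setT (fun t : R => (t `^ (- b))%:E).
  by apply/measurable_EFinP; exact: measurable_powR.
have ndA : nondecreasing_seq A.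
  apply/nondecreasing_seqP => k; apply/subsetPset => t /=; rewrite /A /= !in_itv /=.
  move=> /andP[kt ->]; rewrite andbT; apply: le_trans kt.
  by rewrite lef_pV2 ?posrE// ler_nat.
have := @ge0_nondecreasing_set_cvg_integral _ (measurableTypeR R) R A
  (fun t => (t `^ (- b))%:E) (@lebesgue_measure R)
  ndA (fun k => measurable_itv _) (fun k => measurable_funTS mpow)
  (fun k t _ => powR_ge0 _ _).
move=> /cvge_to_le; apply.
have [k0 k0L] : exists k, 0 + k.+1%:R^-1 < L by exact: ltr_add_invr.
exists k0 => // k /= k0k.
have kL : k.+1%:R^-1 < L.
  by rewrite (le_lt_trans _ k0L)// add0r lef_pV2 ?posrE// ler_nat.
have k_gt0 : (0 : R) < k.+1%:R^-1 by rewrite invr_gt0.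
pose F (t : R) : R := (1 - b)^-1 * t `^ (1 - b).
have dF (t : R) : 0 < t -> is_derive t 1 F (t `^ (- b)).
  move=> t0; have := @is_derive1_powR R (1 - b) t t0.
  move=> d; have := @is_deriveZ _ _ _ (fun t => t `^ (1 - b)) (1 - b)^-1 t 1 _ d.
  rewrite /GRing.scale /= mulrA mulVf ?gt_eqF// mul1r.
  by rewrite addrAC subrr add0r; exact.
have cF (t : R) : 0 < t -> {for t, continuous F}.
  move=> t0; apply/differentiable_continuous/derivable1_diffP.
  by have [] := dF t t0.
rewrite (@continuous_FTC2 R (fun t => t `^ (- b)) F)//; first last.
- move=> t; rewrite in_itv/= => /andP[kt _].
  rewrite derive1E; apply: derive_val; apply: dF; exact: lt_trans kt.
- split.
  + move=> t; rewrite in_itv/= => /andP[kt _].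
    by have [] := dF t (lt_trans k_gt0 kt).
  + exact/cvg_at_right_filter/cF.
  + exact/cvg_at_left_filter/cF.
- apply: continuous_in_subspaceT => t; rewrite inE/= in_itv/= => /andP[kt _].
  by apply: continuous_powR; exact: lt_le_trans kt.
rewrite -EFinB lee_fin /F mulrC lerBlDr lerDl mulr_ge0 ?powR_ge0//.
by rewrite invr_ge0 ltW.
Qed.

(** A pointwise substitute for Hölder's inequality: if r > s, then r / s >= 1 and r = s (r / s) <= s
    (r / s)^p, which is the last summand. *)
Lemma le_powR_weight (p s r : R) : 1 <= p -> 0 < s -> 0 <= r ->
  r <= s + r `^ p * s `^ (1 - p).
Proof.
move=> p1 s0 r0; have [rs|sr] := leP r s.
  by rewrite ler_wpDr// mulr_ge0 ?powR_ge0.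
rewrite ler_wpDl ?(ltW s0)//.
have -> : r `^ p * s `^ (1 - p) = s * (r / s) `^ p.
  rewrite powRM ?invr_ge0 ?(ltW s0)// powRB; last by rewrite (gt_eqF s0) implybT.
  rewrite powRr1 ?(ltW s0)// -(powR_inv1 (ltW s0)) -powRrM mulN1r powRN.
  by rewrite mulrCA !mulrA.
rewrite -ler_pdivrMl// mulrC le1r_powR// ler_pdivlMr// mul1r ltW//.
Qed.

(** With b = m / (p - 1), this is l^(p-1) / (2 K) for l = (1 - b) / (2 K), the factor of the weight
    that does not depend on L. *)
Definition radial_const (m : nat) (p K : R) : R :=
  ((1 - m%:R / (p - 1)) / (2 * K)) `^ (p - 1) / (2 * K).

Lemma radial_const_gt0 (m : nat) (p K : R) : m.+1%:R < p -> 0 < K ->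
  0 < radial_const m p K.
Proof.
move=> mp K0; rewrite -natr1 in mp.
have p1 : 0 < p - 1 by have : 0 <= m%:R :> R by []; lra.
rewrite divr_gt0 ?mulr_gt0// powR_gt0// divr_gt0 ?mulr_gt0// subr_gt0.
by rewrite ltr_pdivrMr// mul1r ltrBrDr.
Qed.

(* Integrating [g <= s + g^p s^(1-p)] with [s = lambda t^(- m / (p - 1))]
   turns the weight [s^(1-p)] into a multiple of [t^m], and [s] stays integrable
   at 0 because [m + 1 < p]; [lambda] is chosen to absorb half of [K^-1]. *)
Lemma radial_bound (m : nat) (p K L : R) (g : R -> \bar R) :
  m.+1%:R < p -> 0 < K -> 0 < L -> measurable_fun setT g ->
  (forall t, 0 <= g t)%E ->
  ((K^-1)%:E <= \int[mu]_(t in `]0%R, L]) g t)%E ->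
  ((radial_const m p K * L `^ (m.+1%:R - p))%:E <=
    \int[mu]_(t in `]0%R, L]) (g t `^ p * (t ^+ m)%:E))%E.
Proof.
move=> mp K0 L0 mg g0 Kg.
have mp' : m%:R + 1 < p by rewrite natr1.
have m0 : 0 <= m%:R :> R by [].
have p1 : 0 < p - 1 by lra.
pose b : R := m%:R / (p - 1).
have b0 : 0 <= b by rewrite divr_ge0// ltW.
have b1 : b < 1 by rewrite ltr_pdivrMr// mul1r ltrBrDr.
have b1' : 0 < 1 - b by rewrite subr_gt0.
(* Chosen so that lam L^(1-b) / (1-b), the bound for the integral of lam t^(-b), is exactly 1 / (2
   K). *)
pose lam : R := (1 - b) / (2 * K) * L `^ (b - 1).
have lam0 : 0 < lam by rewrite mulr_gt0 ?powR_gt0// divr_gt0// mulr_gt0.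
have mgp : measurable_fun setT (fun t => g t `^ p * (t ^+ m)%:E)%E.
  apply: emeasurable_funM; first exact: measurableT_comp (measurable_poweR _) mg.
  by apply/measurable_EFinP; exact: measurable_funX.
have mpow : measurable_fun setT (fun t : R => (t `^ (- b))%:E).
  by apply/measurable_EFinP; exact: measurable_powR.
pose I := (\int[mu]_(t in `]0%R, L]) (g t `^ p * (t ^+ m)%:E))%E.
have I0 : (0 <= I)%E.
  apply: integral_ge0 => t; rewrite /= in_itv/= => /andP[t0 _].
  by rewrite mule_ge0 ?poweR_ge0// lee_fin exprn_ge0// ltW.
have pointwise t : 0 < t ->
    (g t <= lam%:E * (t `^ (- b))%:E + (lam `^ (1 - p))%:E * (g t `^ p * (t ^+ m)%:E))%E.
  move=> t0.
  have tb0 : 0 < t `^ (- b) by exact: powR_gt0.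
  have lp0 : 0 < lam `^ (1 - p) by exact: powR_gt0.
  have -> : t ^+ m = (t `^ (- b)) `^ (1 - p).
    rewrite -powRrM -powR_mulrn ?ltW//; congr powR.
    by rewrite /b; field; rewrite gt_eqF.
  have := g0 t; case: (g t) => [r| |] //.
    rewrite lee_fin => r0; rewrite poweR_EFin -!EFinM -EFinD lee_fin.
    rewrite mulrCA -powRM ?(ltW lam0) ?(ltW tb0)//.
    by apply: le_powR_weight => //; [lra|exact: mulr_gt0].
  move=> _; rewrite poweRyr ?gt_eqF//; last by lra.
  by rewrite gt0_mulye ?lte_fin ?powR_gt0// gt0_muley ?lte_fin//.
have : ((K^-1)%:E <= (2 * K)^-1%:E + (lam `^ (1 - p))%:E * I)%E.
  apply: le_trans Kg _.
  apply: (@le_trans _ _ (\int[mu]_(t in `]0%R, L])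
    (lam%:E * (t `^ (- b))%:E + (lam `^ (1 - p))%:E * (g t `^ p * (t ^+ m)%:E)))%E).
    apply: ge0_le_integral => //=.
    - exact: measurable_funTS.
    - apply: measurable_funTS; apply: emeasurable_funD; exact: measurable_funeM.
    - by move=> t; rewrite in_itv/= => /andP[t0 _]; exact: pointwise.
  rewrite ge0_integralD//=; last 4 first.
  - by move=> t _; rewrite mule_ge0// lee_fin ?powR_ge0// ltW.
  - by apply: measurable_funTS; exact: measurable_funeM.
  - move=> t; rewrite in_itv/= => /andP[t0 _].
    by rewrite mule_ge0 ?lee_fin ?powR_ge0// mule_ge0 ?poweR_ge0// lee_fin exprn_ge0// ltW.
  - by apply: measurable_funTS; exact: measurable_funeM.
  rewrite !ge0_integralZl_EFin ?powR_ge0 ?(ltW lam0)//=; last 4 first.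
  - by move=> t; rewrite in_itv/= => /andP[t0 _];
      rewrite mule_ge0 ?poweR_ge0// lee_fin exprn_ge0// ltW.
  - exact: measurable_funTS.
  - by move=> t _; rewrite lee_fin powR_ge0.
  - exact: measurable_funTS.
  apply: leeD => //.
  apply: le_trans (lee_wpmul2l _ (@le_integral_powR b L _ L0)) _.
  - by rewrite lee_fin ltW.
  - by rewrite b0.
  have LL : L `^ (b - 1) * L `^ (1 - b) = 1.
    by rewrite -powRD ?(gt_eqF L0) ?implybT// addrA subrK subrr powRr0.
  rewrite -EFinM lee_fin le_eqVlt; apply/orP; left; apply/eqP.
  transitivity ((2 * K)^-1 * (L `^ (b - 1) * L `^ (1 - b))); last by rewrite LL mulr1.
  by rewrite /lam; field; rewrite !gt_eqF.
rewrite -/I; move: I0; case: I => [I| |] //; last first.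
  by move=> _ _; rewrite leey.
rewrite -EFinM -EFinD !lee_fin => I0 KI.
have -> : radial_const m p K * L `^ (m.+1%:R - p) = (2 * K)^-1 * lam `^ (p - 1).
  have q0 : 0 <= (1 - b) / (2 * K) by rewrite divr_ge0 ?mulr_ge0// ltW.
  (* Since b (p - 1) = m, one has (b - 1) (p - 1) = m + 1 - p. *)
  have -> : L `^ (m.+1%:R - p) = (L `^ (b - 1)) `^ (p - 1).
    rewrite -powRrM; congr powR; rewrite /b -natr1; field.
    by rewrite gt_eqF.
  by rewrite /radial_const -/b /lam (powRM _ q0 (powR_ge0 _ _)) mulrAC mulrC.
have lp0 : 0 < lam `^ (p - 1) by exact: powR_gt0.
have -> : I = (lam `^ (1 - p) * I) * lam `^ (p - 1).
  rewrite mulrAC -powRD; last by rewrite (gt_eqF lam0) implybT.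
  by rewrite addrA subrK subrr powRr0 mul1r.
rewrite ler_pM2r//.
have : K^-1 = (2 * K)^-1 + (2 * K)^-1 by field; rewrite gt_eqF.
lra.
Qed.

End radial.

(** * Radial curves and the modulus *)

Section euclidean_norm.
Context {R : realType} {n : nat}.
Implicit Types (x v : 'rV[R]_n) (a r : R).

Lemma enorm_ge0 x : 0 <= enorm x.
Proof. exact: sqrtr_ge0. Qed.

Lemma enormZ a x : enorm (a *: x) = `|a| * enorm x.
Proof.
rewrite /enorm; under eq_bigr do rewrite mxE exprMn.
by rewrite -mulr_sumr sqrtrM ?sqr_ge0// sqrtr_sqr.
Qed.

Lemma enormN x : enorm (- x) = enorm x.
Proof. by rewrite -scaleN1r enormZ normrN1 mul1r. Qed.

Lemma enorm0 : enorm (0 : 'rV[R]_n) = 0.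
Proof. by rewrite -(scale0r 0) enormZ normr0 mul0r. Qed.

Lemma ler_coord_enorm x i : `|x 0 i| <= enorm x.
Proof.
rewrite -sqrtr_sqr /enorm ler_wsqrtr// (bigD1 i)//= lerDl.
by apply: sumr_ge0 => j _; exact: sqr_ge0.
Qed.

Lemma enorm_le_box a x : 0 <= a -> (forall i, `|x 0 i| <= a) ->
  enorm x <= Num.sqrt n%:R * a.
Proof.
move=> a0 xa; rewrite -[X in _ * X]ger0_norm// -sqrtr_sqr -sqrtrM// ler_wsqrtr//.
rewrite (@le_trans _ _ (\sum_(i < n) a ^+ 2))//.
  apply: ler_sum => i _; rewrite -[x 0 i ^+ 2]ger0_norm ?sqr_ge0// normrX.
  by rewrite lerXn2r// nnegrE.
by rewrite sumr_const card_ord mulr_natl.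
Qed.

Lemma continuous_enorm : continuous (@enorm R n).
Proof.
move=> x.
have sumc (s : seq 'I_n) :
    {for x, continuous (fun y : 'rV[R]_n => \sum_(i <- s) y 0 i ^+ 2)}.
  elim: s => [|i s IH].
    rewrite (_ : (fun y : 'rV[R]_n => _) = cst 0); first exact: cst_continuous.
    by apply/funext => y; rewrite big_nil.
  rewrite (_ : (fun y : 'rV[R]_n => _) =
    (fun y => y 0 i ^+ 2) \+ (fun y => \sum_(i <- s) y 0 i ^+ 2)); last first.
    by apply/funext => y; rewrite big_cons.
  apply: (@continuousD _ R^o _ _ _ _ _ IH).
  apply: (@continuous_comp _ _ _ (fun y : 'rV[R]_n => y 0 i) (fun u => u ^+ 2)).
    exact: coord_continuous.
  exact: exprn_continuous.
exact: (continuous_comp (sumc _) (@sqrt_continuous R _)).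
Qed.

Lemma open_enorm_lt r : open [set x : 'rV[R]_n | enorm x < r].
Proof.
rewrite (_ : [set x | _] = @enorm R n @^-1` [set y | y < r])//.
by apply: open_comp => [? _|]; [exact: continuous_enorm|exact: open_lt].
Qed.

Lemma closed_enorm_le r : closed [set x : 'rV[R]_n | enorm x <= r].
Proof.
rewrite (_ : [set x | _] = @enorm R n @^-1` [set y | y <= r])//.
by apply: closed_comp => [? _|]; [exact: continuous_enorm|exact: closed_le].
Qed.

Lemma compact_enorm_le r : compact [set x : 'rV[R]_n | enorm x <= r].
Proof.
have cbox : compact [set v : 'rV[R]_n | forall i, `[- r, r]%classic (v ord0 i)].
  by apply: (@rV_compact _ _ (fun=> `[- r, r]%classic)) => _; exact: segment_compact.
apply: subclosed_compact (@closed_enorm_le r) cbox _ => x /= xr i.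
by rewrite in_itv /= -ler_norml (le_trans (ler_coord_enorm _ _)).
Qed.

Lemma eball0E r : eball (0 : 'rV[R]_n) r = [set x | enorm x < r].
Proof. by apply/seteqP; split => x; rewrite /eball /= subr0. Qed.

Lemma scale_unif_continuous v (e : R) : 0 < e ->
  exists2 d : R, 0 < d & forall s t : R, `|s - t| < d -> ball (s *: v) e (t *: v).
Proof.
move=> e0; have v1 : 0 < `|v| + 1 by rewrite ltr_wpDl.
exists (e / (`|v| + 1)); first by rewrite divr_gt0.
move=> s t; rewrite ltr_pdivlMr// => ste.
rewrite mx_norm_ball /ball_ /= -scalerBl normrZ.
by apply: le_lt_trans ste; rewrite ler_wpM2l// lerDl.
Qed.

End euclidean_norm.

(** The time is the minimum of the compact set of t in [a, b] with phi t >= r; equality holds there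
    because all earlier values are below r and [phi] is continuous from the left. *)
Lemma first_crossing {R : realType} (phi : R -> R) (a b r : R) :
  continuous phi -> a <= b -> phi a < r -> r <= phi b ->
  exists t, [/\ a < t <= b, phi t = r & forall s, a <= s < t -> phi s < r].
Proof.
move=> cphi ab phia phib.
pose A := `[a, b]%classic `&` [set t | r <= phi t].
have cA : compact A.
  apply: compact_closedI; first exact: segment_compact.
  rewrite (_ : [set t | _] = phi @^-1` [set y | r <= y])//.
  by apply: closed_comp => [? _|]; [exact: cphi|exact: closed_ge].
have A0 : A !=set0 by exists b; split => //=; rewrite in_itv/= ab lexx.
have [|t] := @compact_EVT_min _ R id A A0 cA.
  by apply: continuous_subspaceT => x; exact: cvg_id.
rewrite inE => -[/= + rt] tmin; rewrite in_itv/= => /andP[at_ tb].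
have lt_r s : a <= s < t -> phi s < r.
  move=> /andP[as_ st]; rewrite ltNge; apply/negP => rs.
  have : t <= s.
    by apply: tmin; rewrite inE; split => //=; rewrite in_itv/= as_ ltW// (lt_le_trans st).
  by rewrite leNgt st.
have at' : a < t.
  by rewrite lt_neqAle at_ andbT; apply: contraTneq rt => <-; rewrite -ltNge.
exists t; split => //; first by rewrite at'.
apply/eqP; rewrite eq_le rt andbT.
apply: (cvgr_to_le (cvg_at_left_filter (cphi t))).
by near=> s; apply/ltW/lt_r; apply/andP; split; near: s; [exact: nbhs_left_ge|exact: nbhs_left_lt].
Unshelve. all: by end_near. Qed.

Section radial_curves.
Context {R : realType} {n : nat}.
Notation mu := (@lebesgue_measure R).
Variables (v : 'rV[R]_n) (c : R -> R) (h : R -> 'rV[R]_n) (a b : R).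
Hypotheses (ab : a < b) (v0 : 0 < enorm v).
Hypothesis ndc : forall s t, s <= t -> c s <= c t.
Hypothesis cc : continuous c.
Hypothesis hE : forall t, h t = c t *: v.

(** Along a ray the polygonal sums are |v| times the variation of the monotone [c], so every
    partition gives the same value. *)
Lemma arclength_radial t : a <= t ->
  arclength h a t = ((c t - c a) * enorm v)%:E.
Proof.
move=> at_; rewrite /arclength.
have sumE s : itv_partition a t s ->
    \sum_(0 <= k < size s) enorm (h (nth t (a :: s) k.+1) - h (nth t (a :: s) k)) =
    (c t - c a) * enorm v.
  move=> ats; rewrite -(@nondecreasing_variation _ a t c s)//; last first.
    by move=> x y _ _; exact: ndc.
  rewrite /variation mulr_suml; apply: eq_bigr => k _.
  by rewrite !hE -scalerBl enormZ.
rewrite (_ : [set _ | _ in _] = [set ((c t - c a) * enorm v)%:E]) ?ereal_sup1//.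
apply/seteqP; split => [_ [s ats <-]|_ ->] /=; first by rewrite sumE.
have [s ats] : itv_partition a t !=set0.
  move: at_; rewrite le_eqVlt => /predU1P[<-|at_]; first by exists [::].
  by exists [:: t]; exact: itv_partition1.
by exists s => //; rewrite sumE.
Qed.

(** [c] may be constant on intervals, so the time picked by [xget] need not be unique; all
    candidates share the value of [c], hence that of [h]. *)
Lemma arc_param_radial u : 0 <= u <= (c b - c a) * enorm v ->
  arc_param (Curve a b h) u = (c a + u / enorm v) *: v.
Proof.
move=> /andP[u0 ub]; rewrite /arc_param /=.
have [t [/andP[at_ tb] tu]] : exists t, a <= t <= b /\ (c t - c a) * enorm v = u.
  have cab : c a <= c b by apply: ndc; exact: ltW.
  have [||t] := @IVT R c a b (c a + u / enorm v) (ltW ab).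
  - exact: continuous_subspaceT.
  - rewrite (min_idPl cab) (max_idPr cab) lerDl divr_ge0 ?(ltW v0)//=.
    by rewrite addrC -lerBrDr ler_pdivrMr.
  - rewrite in_itv/= => tab ct; exists t; split => //.
    by rewrite ct addrC addKr divfK ?gt_eqF.
have ex : exists s, [set s | a <= s <= b /\ arclength h a s = u%:E] s.
  by exists t; rewrite /= at_ tb arclength_radial// tu.
have [/andP[as_ sb]] := @xgetPex _ a _ ex.
set s := xget _ _ => sE; move: sE; rewrite arclength_radial// => -[<-].
by rewrite mulfK ?gt_eqF// addrC subrK hE.
Qed.

(** After the substitution s = c a + u / |v| the integral runs over [c a, c b], which is enlarged to
    ]0, L]; this removes all dependence on the particular lift. *)
Lemma line_integral_radial (rho : 'rV[R]_n -> \bar R) (L : R) :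
  measurable_fun [set: borel_rV R n] rho -> (forall x, 0 <= rho x)%E ->
  0 <= c a -> c b <= L ->
  (line_integral rho (Curve a b h) <=
    (enorm v)%:E * \int[mu]_(s in `]0%R, L]) rho (s *: v))%E.
Proof.
move=> mrho rho0 ca0 cbL.
have cab : c a <= c b by apply: ndc; exact: ltW.
have l0 : 0 <= (c b - c a) * enorm v by rewrite mulr_ge0 ?subr_ge0// ltW.
have mg : measurable_fun setT (fun s : R => rho (s *: v)).
  apply: measurableT_comp mrho _; apply: measurable_fun_rV => i.
  by under eq_fun do rewrite mxE; exact: measurable_funM.
rewrite /line_integral {1}/curve_length /= arclength_radial ?(ltW ab)//=.
have -> : (\int[mu]_(u in `[0%R, ((c b - c a) * enorm v)%R]) rho (arc_param (Curve a b h) u) =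
    \int[mu]_(u in `[0%R, ((c b - c a) * enorm v)%R]) rho ((c a + u / enorm v) *: v)%R)%E.
  apply: eq_integral => u; rewrite inE/= in_itv/= => ub.
  by congr rho; exact: arc_param_radial ub.
pose g := (fun s : R => rho (s *: v)) \_ `[0, L]%classic.
have mg' : measurable_fun setT g.
  exact: iffLR (measurable_restrictT _ (measurable_itv _)) (measurable_funTS mg).
have g0 s : (0 <= g s)%E by rewrite /g /patch; case: ifPn.
rewrite (integral_itv_obnd_cbnd); last exact: measurable_funTS.
have -> : (\int[mu]_(s in `[0%R, L]) rho (s *: v)%R = \int[mu]_s g s)%E.
  by rewrite [LHS]integral_mkcond.
have vi0 : 0 < (enorm v)^-1 by rewrite invr_gt0.
rewrite (ge0_integral_affine (c a) vi0 mg' g0) muleA -EFinM divff ?gt_eqF// mul1e.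
rewrite integral_mkcond; apply: ge0_le_integral => //=.
- by move=> u _; rewrite /patch; case: ifPn.
- apply: (iffLR (measurable_restrictT _ (measurable_itv _))); apply: measurable_funTS.
  apply: (measurableT_comp mg); apply: measurable_funD => //.
  exact: measurable_funM.
- apply: (measurableT_comp mg'); apply: measurable_funD => //.
- move=> u _; rewrite {1}/patch; case: ifPn => // /[!inE]/= /[!in_itv]/= /andP[u0 ul].
  rewrite /g patchE ifT; first by rewrite addrC mulrC.
  have u'0 : 0 <= (enorm v)^-1 * u by rewrite mulr_ge0// ltW.
  rewrite inE/= in_itv/= addr_ge0//= (le_trans _ cbL)//.
  by rewrite mulrC -lerBrDr ler_pdivrMr.
Qed.

End radial_curves.

(** * Integration over a cone of rays *)

Section cone.
Context {R : realType} {m : nat}.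
Notation mu := (@lebesgue_measure R).

Lemma scale_cons_rV (t x : R) (w : 'rV[R]_m) :
  t *: (cons_rV (x, w) : 'rV[R]_m.+1) = cons_rV (t * x, t *: w).
Proof.
apply/rowP => i; rewrite /cons_rV !mxE /=.
by case: unliftP => [j _|_] /=; rewrite ?mxE.
Qed.

(** The Jacobian arises slice by slice, by scaling the hyperplane at height t, and Tonelli then
    exchanges t and w. The cube of directions has measure 1, so integrating [radial_bound] over it
    costs no constant. *)
Lemma cone_lower_bound (p K L : R) (rho : 'rV[R]_m.+1 -> \bar R) :
  m.+1%:R < p -> 0 < K -> 0 < L ->
  measurable_fun [set: borel_rV R m.+1] rho -> (forall x, 0 <= rho x)%E ->
  (forall w : 'rV[R]_m, (forall i, 0 <= w 0 i <= 1) ->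
    ((K^-1)%:E <= \int[mu]_(t in `]0%R, L])
      rho (t *: (cons_rV (1%R, w) : 'rV[R]_m.+1)))%E) ->
  ((radial_const m p K * L `^ (m.+1%:R - p))%:E <=
    \int[lebesgue_rV m.+1]_x (rho x `^ p))%E.
Proof.
move=> mp K0 L0 mrho rho0 Krho.
pose D : set R := `]0%R, L]%classic.
have D0 (t : R) : 0 <= \1_D t * t ^+ m.
  rewrite indicE; case: (boolP (t \in D)) => [|_]; last by rewrite mul0r.
  by rewrite inE /D /= in_itv/= => /andP[t0 _]; rewrite mul1r exprn_ge0// ltW.
have mrhop : measurable_fun [set: borel_rV R m.+1] (fun x => rho x `^ p)%E.
  exact: measurableT_comp (measurable_poweR _) mrho.
have rhop0 x : (0 <= rho x `^ p)%E by exact: poweR_ge0.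
have mt : measurable_fun setT (fun t : measurableTypeR R => (\1_D t * t ^+ m)%:E).
  apply/measurable_EFinP; apply: measurable_funM; last exact: measurable_funX.
  by apply: measurable_indic; exact: measurable_itv.
pose H (z : measurableTypeR R * borel_rV R m) : \bar R :=
  (rho (cons_rV (z.1, z.1 *: (z.2 : 'rV[R]_m))) `^ p * (\1_D z.1 * z.1 ^+ m)%:E)%E.
have mH : measurable_fun setT H.
  apply: emeasurable_funM; last first.
    exact: (measurableT_comp mt measurable_fst).
  apply: (measurableT_comp mrhop); apply: (measurableT_comp measurable_cons_rV).
  by apply: measurable_fun_pair; [exact: measurable_fst|exact: measurable_scale_rV].
have H0 z : (0 <= H z)%E by rewrite mule_ge0 ?lee_fin.
have fib_le t : (\int[lebesgue_rV m]_w H (t, w) <=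
    \int[lebesgue_rV m]_w (rho (cons_rV (t, w)) `^ p))%E.
  rewrite /H /= indicE; case: (boolP (t \in D)) => [|_]; last first.
    rewrite mul0r; under eq_integral do rewrite mule0.
    by rewrite integral0; apply: integral_ge0 => w _.
  rewrite inE /D /= in_itv/= => /andP[t0 _]; rewrite mul1r.
  have mcons : measurable_fun setT (fun w : borel_rV R m => rho (cons_rV (t, w)) `^ p)%E.
    apply: (measurableT_comp mrhop); apply: (measurableT_comp measurable_cons_rV).
    exact: pair1_measurable.
  rewrite (ge0_integral_scale_rV t0 mcons)// -ge0_integralZl_EFin//.
  - by under eq_integral do rewrite muleC.
  - apply: (measurableT_comp mcons); apply: measurable_fun_rV => i.
    under eq_fun do rewrite mxE.
    by apply: measurable_funM => //; exact: measurable_coord.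
  - by rewrite exprn_ge0// ltW.
have mpair : measurable_fun setT (fun z => rho (cons_rV z) `^ p)%E.
  exact: (measurableT_comp mrhop measurable_cons_rV).
pose W := [set w : 'rV[R]_m | forall i, 0 <= w 0 i <= 1].
have mW : measurable (W : set (borel_rV R m)) by exact: measurable_box.
set C := radial_const m p K * L `^ (m.+1%:R - p).
have C0 : 0 <= C.
  by rewrite mulr_ge0 ?powR_ge0// ltW// radial_const_gt0.
rewrite ge0_integral_lebesgue_rVS//.
apply: (@le_trans _ _ (\int[mu]_t \int[lebesgue_rV m]_w H (t, w))%E); last first.
  apply: ge0_le_integral => //=.
  - by move=> t _; exact: integral_ge0.
  - exact: (@measurable_fun_fubini_tonelli_F _ _ _ _ _ (lebesgue_rV m) H mH H0).
  - exact: (@measurable_fun_fubini_tonelli_F _ _ _ _ _ (lebesgue_rV m) _ mpair (fun=> rhop0 _)).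
rewrite (fubini_tonelli H mH H0).
have -> : C%:E = (\int[lebesgue_rV m]_w (C%:E * (\1_W w)%:E))%E.
  rewrite ge0_integralZl_EFin//; last exact/measurable_EFinP/measurable_indic.
  have := @lebesgue_rV_box R m 0 1 ler01; rewrite subr0 expr1n -/W => W1.
  rewrite integral_indic// setIT -[LHS]mule1; congr (_ * _)%E; exact: esym W1.
apply: ge0_le_integral => //=.
- by move=> w _; rewrite mule_ge0.
- by apply: measurable_funeM; exact/measurable_EFinP/measurable_indic.
- exact: (@measurable_fun_fubini_tonelli_G _ _ _ _ _ mu H mH H0).
move=> w _; rewrite indicE; case: (boolP (w \in W)) => [|_]; last first.
  by rewrite mule0; exact: integral_ge0.
rewrite inE mule1 => Ww.
have mg : measurable_fun setT
    (fun t : R => rho (t *: (cons_rV (1%R, w) : 'rV[R]_m.+1))).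
  apply: (measurableT_comp mrho); apply: measurable_fun_rV => i.
  by under eq_fun do rewrite mxE; exact: measurable_funM.
have := radial_bound mp K0 L0 mg (fun=> rho0 _) (Krho w Ww).
move=> /le_trans; apply; rewrite integral_mkcond.
rewrite le_eqVlt; apply/orP; left; apply/eqP; apply: eq_integral => t _.
rewrite patchE /H indicE /=; case: ifPn => [tD|tD].
  by rewrite scale_cons_rV mulr1 mul1r.
by rewrite mul0r mule0.
Qed.

End cone.

(** * Lower bound for the modulus of the image of a ring *)

Section modulus_lower_bound.
Context {R : realType} {m : nat}.
Notation mu := (@lebesgue_measure R).
Variables (f : 'rV[R]_m.+1 -> 'rV[R]_m.+1) (r1 r2 L p : R).
Hypotheses (r10 : 0 < r1) (r12 : r1 < r2) (r21 : r2 < 1) (L0 : 0 < L).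
Hypothesis mp : m.+1%:R < p.
Hypothesis cf : {within eball 0 1, continuous f}.
Hypothesis of_ : open_mapping (eball 0 1) f.
Hypothesis df : discrete_mapping (eball 0 1) f.
Hypothesis f0 : f 0 = 0.
Hypothesis fL : forall x, enorm x <= r2 -> enorm (f x) <= L.

(** With |v| >= 1, |t v| > L from t = L + 1 on, so the ray is then outside the image of the closed
    ball of radius [r2]. This is the exit condition of [path_lift]. *)
Lemma radial_lift (v : 'rV[R]_m.+1) : 1 <= enorm v ->
  exists (alpha : R -> 'rV[R]_m.+1) (c : R -> R) (T : R),
  [/\ continuous alpha, alpha 0 = 0, 0 < T, r2 <= enorm (alpha T) &
   [/\ (forall t, f (alpha t) = c t *: v), c 0 = 0 &
     forall s t, s <= t -> c s <= c t <= c s + (t - s)]].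
Proof.
move=> v1; have v0 : 0 < enorm v by apply: lt_le_trans v1.
(* A radius strictly between [r2] and 1: the closed ball of radius r' is compact inside the domain
   and leaves room around the ball of radius [r2]. *)
pose r' := (r2 + 1) / 2.
have r2r' : r2 < r' by rewrite ltr_pdivlMr// mulr_natr mulr2n ltrD2l.
have r'1 : r' < 1 by rewrite ltr_pdivrMr// mul1r -[ltRHS]/(1 + 1) ltrD2r.
have r20 : 0 < r2 by exact: lt_trans r12.
have oD : open (eball (0 : 'rV[R]_m.+1) 1) by rewrite eball0E; exact: open_enorm_lt.
have K0U : [set x : 'rV[R]_m.+1 | enorm x <= r2] `<=` [set x | enorm x < r'].
  by move=> x /= /le_lt_trans; apply.
have UK1 : [set x : 'rV[R]_m.+1 | enorm x < r'] `<=` [set x | enorm x <= r'].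
  by move=> x /ltW.
have K1D : [set x : 'rV[R]_m.+1 | enorm x <= r'] `<=` eball 0 1.
  by rewrite eball0E => x /= /le_lt_trans; apply.
have cfD x : eball 0 1 x -> {for x, continuous f}.
  move=> Dx; move: cf; rewrite (continuous_open_subspace f oD) => /(_ x); apply.
  by rewrite inE.
have K0x0 : [set x : 'rV[R]_m.+1 | enorm x <= r2] 0 by rewrite /= enorm0 ltW.
have fx0 : f 0 = 0 *: v by rewrite f0 scale0r.
have exit t : L + 1 <= t -> forall x, [set x | enorm x <= r2] x -> f x <> t *: v.
  move=> Lt x /fL; apply: contraPnot => ->; apply/negP; rewrite -ltNge enormZ.
  have Lt' : L < t by apply: lt_le_trans Lt; rewrite ltrDl.
  rewrite gtr0_norm ?(lt_trans L0)//; apply: (lt_le_trans Lt').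
  by rewrite ler_peMr// ltW// (lt_trans L0).
have [alpha [c [calpha alpha0 _ falpha [c0 c_lip [T T0 aT]]]]] :=
  path_lift (@norm_hausdorff _ _) (@norm_hausdorff _ _) (@compact_enorm_le _ _ _)
    (@compact_enorm_le _ _ _) (@open_enorm_lt _ _ _) K0U UK1 K1D cfD of_ df
    (@scale_unif_continuous _ _ v) K0x0 fx0 exit.
exists alpha, c, T; split => //.
rewrite leNgt; apply/negP => aTlt; apply: aT.
suff : [set x : 'rV[R]_m.+1 | enorm x < r2] `<=` [set x | enorm x <= r2]° by apply.
by rewrite -open_subsetE; [move=> x /ltW|exact: open_enorm_lt].
Qed.

Lemma radial_curve (v : 'rV[R]_m.+1) : 1 <= enorm v ->
  exists (alpha : R -> 'rV[R]_m.+1) (c : R -> R) (a b : R),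
  [/\ a < b, curve_family (esphere 0 r1) (esphere 0 r2) (ering 0 r1 r2)
        (Curve a b alpha),
      (forall t, f (alpha t) = c t *: v), continuous c &
      [/\ forall s t, s <= t -> c s <= c t, 0 <= c a & c b <= L]].
Proof.
move=> v1; have [alpha [c [T [calpha alpha0 T0 aT [falpha c0 c_lip]]]]] := radial_lift v1.
have v0 : 0 < enorm v by apply: lt_le_trans v1.
have r20 : 0 < r2 by exact: lt_trans r12.
have cphi : continuous (fun t => enorm (alpha t)).
  by move=> t; apply: continuous_comp; [exact: calpha|exact: continuous_enorm].
have [b [/andP[b0 bT] bE b_lt]] : exists b, [/\ 0 < b <= T, enorm (alpha b) = r2 &
    forall s, 0 <= s < b -> enorm (alpha s) < r2].
  by apply: first_crossing => //; [exact: ltW|rewrite alpha0 enorm0].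
(* The last visit to the inner sphere before time [b] is a first crossing for the negated norm with
   time reversed. *)
have [d [/andP[d0 db] dE d_lt]] : exists d, [/\ 0 < d <= b,
    - enorm (alpha (b - d)) = - r1 &
    forall s, 0 <= s < d -> - enorm (alpha (b - s)) < - r1].
  apply: (@first_crossing _ (fun t => - enorm (alpha (b - t)))).
  - move=> t; apply: cvgN.
    apply: (@continuous_comp _ _ _ (fun t : R => b - t) (fun t => enorm (alpha t)) t); last exact: cphi.
    by apply: cvgB; [exact: cvg_cst|exact: cvg_id].
  - exact: ltW.
  - by rewrite subr0 bE ltrN2.
  - by rewrite subrr alpha0 enorm0 lerN2 ltW.
have ndc s t : s <= t -> c s <= c t by move=> /c_lip/andP[].
exists alpha, c, (b - d), b; split => //.
- by rewrite ltrBlDr ltrDl.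
- split => /=.
  + by rewrite ltrBlDr ltrDl.
  + exact: continuous_subspaceT.
  + by rewrite /esphere /= subr0; apply: oppr_inj.
  + by rewrite /esphere /= subr0.
  + move=> t /andP[bdt tb]; rewrite /ering /= subr0.
    have t0 : 0 <= t by apply: le_trans (ltW bdt); rewrite subr_ge0.
    rewrite b_lt ?t0// andbT -ltrN2.
    have := d_lt (b - t); rewrite subKr; apply.
    by rewrite subr_ge0 ltW//= ltrBlDr -ltrBlDl.
- move=> t; apply/cvgrPdist_lt => e e0; near=> s.
  have ts : `|t - s| < e by near: s; exact: cvgr_dist_lt.
  apply: le_lt_trans ts.
  have [st|/ltW st] := leP s t; have /andP[c1 c2] := c_lip _ _ st.
    by rewrite !ger0_norm ?subr_ge0// lerBlDl.
  by rewrite distrC (distrC t) !ger0_norm ?subr_ge0// lerBlDl.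
split => //; first by rewrite -c0 ndc// subr_ge0.
(* The endpoint has norm [r2], so c b |v| <= L, and |v| >= 1 gives c b <= L. *)
have : enorm (f (alpha b)) <= L by apply: fL; rewrite bE.
rewrite falpha enormZ; apply: le_trans; apply: le_trans (ler_norm _) _.
by rewrite ler_peMr.
Unshelve. all: by end_near. Qed.

(** sqrt (m + 1) bounds the norm of (1, w) for w in the unit cube, so it replaces |v| in the
    admissibility inequality and makes the bound uniform in w. *)
Lemma modulus_lower_bound :
  ((radial_const m p (Num.sqrt m.+1%:R) * L `^ (m.+1%:R - p))%:E <=
  modulus p (image_family f
    (curve_family (esphere 0 r1) (esphere 0 r2) (ering 0 r1 r2))))%E.
Proof.
apply: le_ereal_inf_tmp => _ [rho [mrho rho0 adm] <-].
rewrite (@ge0_integral_leb R m.+1 (fun x => rho x `^ p)%E); last 2 first.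
- exact: measurableT_comp (measurable_poweR _) mrho.
- by move=> x; exact: poweR_ge0.
have K0 : (0 : R) < Num.sqrt m.+1%:R by rewrite sqrtr_gt0.
apply: cone_lower_bound => // w w01.
set v : 'rV[R]_m.+1 := cons_rV (1%R, w).
have v_ge1 : 1 <= enorm v.
  have := ler_coord_enorm v ord0; rewrite /v /cons_rV mxE unlift_none /=.
  by rewrite normr1.
have v_le : enorm v <= Num.sqrt m.+1%:R.
  rewrite -[leRHS]mulr1; apply: enorm_le_box => // i.
  rewrite /v /cons_rV mxE; case: unliftP => [j _|_] /=; last by rewrite normr1.
  by have /andP[? ?] := w01 j; rewrite ger0_norm.
have v0 : 0 < enorm v by apply: lt_le_trans v_ge1.
have [alpha [c [a [b [ab cfam falpha cc [ndc ca cb]]]]]] := radial_curve v_ge1.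
pose g := Curve a b (f \o alpha).
have gfam : image_family f
    (curve_family (esphere 0 r1) (esphere 0 r2) (ering 0 r1 r2)) g.
  by exists (Curve a b alpha).
have rg : rectifiable g.
  by rewrite /rectifiable /curve_length /= (arclength_radial ndc falpha) ?ltry// ltW.
have := adm g gfam rg.
move=> /le_trans /(_ (line_integral_radial ab v0 ndc cc falpha mrho rho0 ca cb)) le1.
have K1 : (1 <= (Num.sqrt m.+1%:R)%:E * \int[mu]_(s in `]0%R, L]) rho (s *: v)%R)%E.
  apply: le_trans le1 _; apply: lee_wpmul2r; last by rewrite lee_fin.
  exact: integral_ge0.
by rewrite -[leLHS]mule1 lee_pdivrMl.
Qed.

End modulus_lower_bound.

(** * The ring inequality *)

Section ring_estimate.
Context {R : realType} {m : nat}.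

Lemma measurable_eball r : measurable (eball 0 r : set (lebesgue_type R m.+1)).
Proof.
apply: measurable_lebesgue_type; apply: sub_sigma_algebra.
by rewrite eball0E; exact: open_enorm_lt.
Qed.

Lemma measurable_ering r1 r2 :
  measurable (ering 0 r1 r2 : set (lebesgue_type R m.+1)).
Proof.
rewrite (_ : ering 0 r1 r2 =
    [set x | r1 < enorm x] `&` [set x | enorm x < r2]); last first.
  by apply/seteqP; split => x; rewrite /ering /= subr0; [case/andP|case=> -> ->].
apply: measurable_lebesgue_type; apply: sub_sigma_algebra; apply: openI.
  rewrite (_ : [set x | _] = @enorm R m.+1 @^-1` [set y | r1 < y])//.
  by apply: open_comp => [? _|]; [exact: continuous_enorm|exact: open_gt].
exact: open_enorm_lt.
Qed.

Lemma leb_eball_fin_pos :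
  exists2 w : R, 0 < w & leb (eball (0 : 'rV[R]_m.+1) 1) = w%:E.
Proof.
have mB : measurable (eball 0 1 : set (borel_rV R m.+1)).
  by apply: sub_sigma_algebra; rewrite eball0E; exact: open_enorm_lt.
rewrite lebE//.
have K0 : (0 : R) < Num.sqrt m.+1%:R by rewrite sqrtr_gt0.
(* The cube [0, a]^(m+1) lies in the ball of radius 1/2, hence in the open unit ball; the cube
   [-1, 1]^(m+1) bounds the ball from outside. *)
pose a : R := (2 * Num.sqrt m.+1%:R)^-1.
have a0 : 0 < a by rewrite invr_gt0 mulr_gt0.
have lo : ((a ^+ m.+1)%:E <= lebesgue_rV m.+1 (eball 0 1))%E.
  rewrite -[X in X ^+ _]subr0 -(lebesgue_rV_box _ (ltW a0)).
  apply: le_measure; rewrite ?inE//; first exact: measurable_box.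
  move=> x xa; rewrite eball0E /=.
  apply: (@le_lt_trans _ _ (Num.sqrt m.+1%:R * a)).
    apply: enorm_le_box => [|i]; first exact: ltW.
    by have /andP[x0 ?] := xa i; rewrite ger0_norm.
  by rewrite /a invfM mulrCA divff ?gt_eqF// mulr1 invf_lt1 ?ltr1n.
have hi : (lebesgue_rV m.+1 (eball (0%R : 'rV[R]_m.+1) 1%R) <= (2 ^+ m.+1)%:E)%E.
  have N11 : -1 <= 1 :> R by rewrite (le_trans (lerN10 R)).
  rewrite [X in (_ <= (X ^+ _)%:E)%E](_ : 2 = 1 - -1 :> R); last by rewrite opprK.
  rewrite -(lebesgue_rV_box _ N11).
  apply: le_measure; rewrite ?inE//; first exact: measurable_box.
  move=> x; rewrite eball0E /= => x1 i.
  by rewrite -ler_norml (le_trans (ler_coord_enorm _ _)) ?ltW.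
move: lo hi; case: (lebesgue_rV m.+1 _) => [w| |] //.
rewrite !lee_fin => lo _; exists w => //; apply: lt_le_trans lo.
by rewrite exprn_gt0.
Qed.

(** This lower bound makes the ring inequality available for every outer radius below 1. *)
Lemma edist_to_boundary : (1%:E <= edist_to (0 : 'rV[R]_m.+1)
  (closure (eball 0 1) `\` (eball 0 1)°))%E.
Proof.
have oD : open (eball (0 : 'rV[R]_m.+1) 1) by rewrite eball0E; exact: open_enorm_lt.
apply: le_ereal_inf_tmp => _ [y [_ +] <-].
rewrite (interior_id _).1// eball0E /= => /negP; rewrite -leNgt => y1.
by rewrite lee_fin sub0r enormN.
Qed.

Lemma completed_lebesgue_measure_itv_oo (r1 r2 : R) : r1 < r2 ->
  completed_lebesgue_measure (`]r1, r2[%classic : set (lebesgue_typeR R)) =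
  (r2 - r1)%:E.
Proof.
move=> r12; transitivity (lebesgue_measure (`]r1, r2[%classic : set R)); first by [].
by rewrite lebesgue_measure_itv /= lte_fin r12.
Qed.

Lemma ring_upper_bound (p : R) (Q : 'rV[R]_m.+1 -> \bar R) f (e : R) :
  (forall x, eball 0 1 x -> (0 <= Q x)%E) ->
  measurable_fun (eball 0 1 : set (lebesgue_type R m.+1)) Q ->
  ring_Q_mapping p (eball 0 1) 0 Q f -> 0 < e < 1 ->
  (modulus p (image_family f (curve_family (esphere 0%R (e / 2)%R) (esphere 0%R e)
      (ering 0%R (e / 2)%R e))) <=
   ((2 / e)%R `^ p)%:E * \int[leb]_(x in eball 0%R e) Q x)%E.
Proof.
move=> Q0 mQ [_ ring] /andP[e0 e1].
have e20 : 0 < e / 2 by rewrite divr_gt0.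
have e2e : e / 2 < e by rewrite ltr_pdivrMr// ltr_pMr// ltr1n.
have eta0 : 0 <= 2 / e by rewrite divr_ge0// ltW.
have ed : (e%:E < edist_to (0%R : 'rV[R]_m.+1) (closure (eball 0 1) `\` (eball 0 1)°))%E.
  by apply: lt_le_trans edist_to_boundary; rewrite lte_fin.
have sub : eball (0 : 'rV[R]_m.+1) e `<=` eball 0 1.
  by rewrite !eball0E => x /= /lt_trans; apply.
have subr : ering (0 : 'rV[R]_m.+1) (e / 2) e `<=` eball 0 e.
  by move=> x /andP[].
have mitv : measurable (`](e / 2), e[%classic : set (lebesgue_typeR R)).
  by apply: sub_caratheodory; exact: measurable_itv.
apply: le_trans (ring _ _ e20 e2e ed (cst (2 / e)%:E) _ _ _) _.
- exact: measurable_cst.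
- by move=> r _; rewrite lee_fin.
- rewrite integral_cst//= [X in (_ * X)%E](completed_lebesgue_measure_itv_oo e2e : _ = _).
  rewrite -EFinM lee_fin.
  rewrite le_eqVlt; apply/orP; left; apply/eqP; field.
  by rewrite gt_eqF.
have mQe : measurable_fun (eball 0 e : set (lebesgue_type R m.+1)) Q.
  by apply: measurable_funS mQ => //; exact: measurable_eball.
have mQr : measurable_fun (ering 0 (e / 2) e : set (lebesgue_type R m.+1)) Q.
  by apply: measurable_funS mQe => //; exact: measurable_eball.
under eq_integral do rewrite poweR_EFin muleC.
rewrite ge0_integralZl_EFin ?powR_ge0//; last 2 first.
- exact: measurable_ering.
- by move=> x /subr/sub/Q0.
apply: lee_wpmul2l; first by rewrite lee_fin powR_ge0.
(* The ring is enlarged to the ball, because the lower density is an average over balls. *)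
apply: ge0_subset_integral => //.
- exact: measurable_ering.
- exact: measurable_eball.
- by move=> x /sub/Q0.
Qed.

End ring_estimate.

(** * Limits at the origin and the conclusion *)

Section limits.
Context {R : realType} {m : nat}.

(** Allows the upper limit to be replaced by real numbers M above it, and settles the case where it
    is infinite. *)
Lemma le_ereal_of_gt (x y : \bar R) : (0 <= y)%E ->
  (forall r : R, (y < r%:E)%E -> (x <= r%:E)%E) -> (x <= y)%E.
Proof.
case: y => [y| |] // _ H; last by rewrite leey.
apply/lee_addgt0Pr => e e0; rewrite -EFinD; apply: H.
by rewrite lte_fin ltrDl.
Qed.

(** Needed to infer that the upper limit of nonnegative quotients is nonnegative, suprema being
    taken over nonempty sets. *)
Lemma dnbhs0_rV_proper : ~ (0 : 'rV[R]_m.+1)^' set0.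
Proof.
move=> /nbhs_ballP[e /= e0]; rewrite mx_norm_ball => eB.
pose w : 'rV[R]_m.+1 := const_mx 1.
have w0 : 0 < `|w|.
  by rewrite normr_gt0; apply/eqP => /rowP/(_ ord0)/eqP; rewrite !mxE oner_eq0.
have := eB ((e / 2 / `|w|) *: w); apply.
  rewrite /ball_ /= sub0r normrN normrZ ger0_norm ?divr_ge0 ?ltW//.
  by rewrite divfK ?gt_eqF// ltr_pdivrMr// ltr_pMr// ltr1n.
have ew0 : 0 < e / 2 / `|w| by rewrite !divr_gt0.
by rewrite scaler_eq0 negb_or (gt_eqF ew0) -normr_gt0 w0.
Qed.

Lemma mx_norm_le_enorm (x : 'rV[R]_m.+1) : `|x| <= enorm x.
Proof.
rewrite [leLHS]/Num.norm /= mx_normrE; apply: bigmax_le => [|i _]; first exact: enorm_ge0.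
by rewrite ord1 ler_coord_enorm.
Qed.

Lemma enorm_gt0 (x : 'rV[R]_m.+1) : x != 0 -> 0 < enorm x.
Proof. by move=> x0; rewrite (lt_le_trans _ (mx_norm_le_enorm x))// normr_gt0. Qed.

(** Neighbourhoods are sup-norm balls; since the sup norm is at most the Euclidean norm, a Euclidean
    ball of the same radius fits inside. *)
Lemma limf_esup_quotient (f : 'rV[R]_m.+1 -> 'rV[R]_m.+1) (M : R) : f 0 = 0 ->
  (limf_esup (fun x : 'rV[R]_m.+1 => (enorm (f x) / enorm x)%:E) (0%R : 'rV[R]_m.+1)^' < M%:E)%E ->
  exists2 d : R, 0 < d & forall x, enorm x < d -> enorm (f x) <= M * enorm x.
Proof.
move=> f0; rewrite limf_esupE => /ereal_inf_lt[_ [V V0 <-] supV].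
have /nbhs_ballP[d /= d0] := V0; rewrite mx_norm_ball => dV.
exists d => // x xd; have [->|x0] := eqVneq x 0.
  by rewrite f0 enorm0 mulr0.
rewrite -ler_pdivrMr ?enorm_gt0// -lee_fin; apply: le_trans (ltW supV).
apply: ereal_sup_ubound; exists x => //; apply: dV => //.
by rewrite /ball_ /= sub0r normrN (le_lt_trans (mx_norm_le_enorm x)).
Qed.

End limits.

Theorem mainTheorem1 (R : realType) (n : nat) (p : R)
    (n_ge2 : (2 <= n)%N) (n_lt_p : n%:R < p) :
  exists c0 : R, 0 < c0 /\
    forall (Q : 'rV[R]_n -> \bar R) (f : 'rV[R]_n -> 'rV[R]_n),
      (forall x, eball 0 1 x -> (0 <= Q x)%E) ->
      locally_integrable_rV (eball 0 1) Q ->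
      (0 < lower_density0 Q)%E ->
      {within eball 0 1, continuous f} ->
      open_mapping (eball 0 1) f ->
      discrete_mapping (eball 0 1) f ->
      f 0 = 0 ->
      ring_Q_mapping p (eball 0 1) 0 Q f ->
      (c0%:E * npoweR (lower_density0 Q) (1 / (n%:R - p))
        <= limf_esup (fun x : 'rV[R]_n => (enorm (f x) / enorm x)%:E) (0%R : 'rV[R]_n)^')%E.
Proof.
case: n n_ge2 n_lt_p => // m _ mp.
have [w w0 wE] := @leb_eball_fin_pos R m.
have K0 : (0 : R) < Num.sqrt m.+1%:R by rewrite sqrtr_gt0.
pose C := radial_const m p (Num.sqrt m.+1%:R).
have C0 : 0 < C by exact: radial_const_gt0.
(* Dividing C (M e)^(n-p) <= (2/e)^p int Q by (2/e)^p w e^n leaves k M^(n-p) below the mean of Q,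
   with n = m + 1 and w the volume of the unit ball. *)
pose k := C / (2 `^ p * w).
have k0 : 0 < k by rewrite divr_gt0// mulr_gt0// powR_gt0.
pose s := p - m.+1%:R.
have s0 : 0 < s by rewrite subr_gt0.
exists (k `^ s^-1); split; first exact: powR_gt0.
move=> Q f Q0 [mQ _] dens0 cf of_ df f0 rQ.
set ell := limf_esup _ _.
have ell0 : (0 <= ell)%E.
  apply: limf_esup_ge0; first exact: dnbhs0_rV_proper.
  by move=> x; rewrite lee_fin divr_ge0 ?enorm_ge0.
(* For an infinite density the convention of [npoweR] makes the left-hand side 0. *)
case qE : (lower_density0 Q) dens0 => [q| |] //; last first.
  by rewrite /npoweR mule0.
rewrite lte_fin => q0; rewrite /npoweR poweR_EFin -EFinM.
apply: le_ereal_of_gt => // M Mell.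
have M0 : 0 < M by rewrite -lte_fin (le_lt_trans ell0).
have [d d0 fM] := limf_esup_quotient f0 Mell.
(* Raised to the power 1 / s, this reads k^(1/s) / M <= q^(1/s), which is the claim with M in place
   of the upper limit. *)
suff kM : ((k * M `^ (- s))%:E <= lower_density0 Q)%E.
  move: kM; rewrite qE lee_fin => kM.
  have s1 : 1 / (m.+1%:R - p) = - s^-1 by rewrite /s mul1r -invrN opprB.
  rewrite lee_fin s1.
  have : (k * M `^ (- s)) `^ s^-1 <= q `^ s^-1.
    apply: ge0_ler_powR; rewrite ?nnegrE ?invr_ge0 ?(ltW s0) ?(ltW q0)//.
    by rewrite mulr_ge0 ?powR_ge0 ?(ltW k0).
  rewrite powRM ?powR_ge0 ?(ltW k0)// -powRrM mulNr divff ?gt_eqF//.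
  rewrite powR_inv1 ?(ltW M0)// ler_pdivrMr// => kq.
  by rewrite powRN ler_pdivrMr ?powR_gt0// mulrC.
rewrite /lower_density0 limf_einfE.
pose e0 := Num.min d 1.
have e00 : 0 < e0 by rewrite lt_min d0 ltr01.
apply: ereal_sup_ge; eexists.
  exists [set e : R | 0 < e < e0] => //.
  by near=> e; apply/andP; split; near: e; [exact: nbhs_right_gt|exact: nbhs_right_lt].
apply: le_ereal_inf_tmp => _ [e /= /andP[ege0 ee0] <-].
move: ee0; rewrite lt_min => /andP[ed e1].
have en0 : 0 < e ^+ m.+1 by rewrite exprn_gt0.
rewrite wE -EFinM inver gt_eqF ?mulr_gt0//.
have fL x : enorm x <= e -> enorm (f x) <= M * e.
  move=> xe; apply: le_trans (fM _ (le_lt_trans xe ed)) _.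
  by rewrite ler_pM2l.
have e20 : 0 < e / 2 by rewrite divr_gt0.
have e2e : e / 2 < e by rewrite ltr_pdivrMr// ltr_pMr// ltr1n.
have Me0 : 0 < M * e by rewrite mulr_gt0.
have lo := modulus_lower_bound e20 e2e e1 Me0 mp cf of_ df f0 fL.
have hi := ring_upper_bound Q0 mQ rQ (introT andP (conj ege0 e1)).
have := le_trans lo hi; rewrite -/C => CI.
have pe0 : 0 < (2 / e) `^ p by rewrite powR_gt0// divr_gt0.
rewrite lee_pdivlMr ?mulr_gt0// -EFinM.
apply: (@le_trans _ _ ((((2 / e) `^ p)^-1)%:E * (C * (M * e) `^ (m.+1%:R - p))%:E)%E); last first.
  by rewrite lee_pdivrMl.
(* Here (e/2)^p (M e)^(n-p) = 2^(-p) M^(-s) e^n, so the bound scales exactly like the volume of the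
   ball and the two sides are equal. *)
rewrite -EFinM lee_fin le_eqVlt; apply/orP; left; apply/eqP.
have -> : m.+1%:R - p = - s by rewrite /s opprB.
rewrite (powRM _ (ltW M0) (ltW ege0)).
have -> : (2 / e) `^ p = 2 `^ p / e `^ p.
  by rewrite powRM ?invr_ge0 ?(ltW ege0)// -powR_inv1 ?(ltW ege0)// -powRrM mulN1r powRN.
have -> : e `^ (- s) = e ^+ m.+1 / e `^ p.
  by rewrite /s opprB powRB ?(gt_eqF ege0) ?implybT// powR_mulrn// ltW.
have two0 : 2 `^ p != 0 :> R by rewrite gt_eqF// powR_gt0.
have ep0 : e `^ p != 0 by rewrite gt_eqF// powR_gt0.
rewrite /k; field.
by rewrite two0 ep0 gt_eqF.
Unshelve. all: by end_near. Qed.
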